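(* Let $\mathcal{H},\mathcal{K}$ be Hilbert spaces, let $(\omega_k)_{k\ge0}$ be a sequence of strictly positive weights, set $\beta(0)=1$ and $\beta(n)=\omega_0\cdots\omega_{n-1}$ for $n\ge1$, and let $S_\omega\in\mathcal{B}(\ell^2(\mathcal{H}))$ be the unilateral weighted shift $S_\omega(x_0,x_1,\ldots)=(0,\omega_0x_0,\omega_1x_1,\ldots)$. Let $T\in\mathcal{B}(\mathcal{K})$ be a coisometry ($TT^*=I$). For $Y\in\mathcal{B}(\ell^2(\mathcal{H}),\mathcal{K})$ write $$R(Y)=\begin{bmatrix}T & Y\\ 0 & S_\omega\end{bmatrix}\in\mathcal{B}(\mathcal{K}\oplus\ell^2(\mathcal{H})),$$ so $R(0)=T\oplus S_\omega$. Let $X\in\mathcal{B}(\ell^2(\mathcal{H}),\mathcal{K})$. Then $R(X)$ is similar to a contraction if and only if $R(X)$ is power bounded and there exist $A\in\mathcal{B}(\ell^2(\mathcal{H}),\mathcal{K})$ and $E\in\mathcal{B}(\mathcal{K}\oplus\ell^2(\mathcal{H}))$ with $E^2=0$, $ER(A)=0$ and $R(X)=R(A)+E$, such that $R(A)$ is $\beta$-quadratically near $R(0)$ modulo $\mathcal{H}$, i.e. there is a constant $s$ with $$\Big\|\sum_{n=0}^{N}\frac{1}{\beta(n)}\big(R(A)^n-R(0)^n\big)x_n\Big\|\le s\Big(\sum_{n=0}^N\|x_n\|^2\Big)^{1/2}$$ for every $N\in\mathbb{N}$ and all $x_0,\ldots,x_N\in\{0\}\oplus(\mathcal{H}\opl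us\{0\}\oplus\{0\}\oplus\cdots)$.
   Context: An operator is power bounded if the norms of its powers are uniformly bounded; it is similar to a contraction if it is conjugate by an invertible operator to an operator of norm at most 1. The statement ''zero-product perturbation by a nilpotent of order two of $R(A)$'' means $R(X)=R(A)+E$ with $E^2=0$ and $ER(A)=0$. *)

(* Defs.v *)
(* Scalars: the complex numbers C = R[i] over an arbitrary real field
   R : realType (mathcomp-real-closed's complex numbers).
   Hilbert space  = complete normed C-module whose norm comes from an inner
   product (sesquilinear, Hermitian, <x,x> = ||x||^2).
   Norms in a normedModType over R[i] take values in R[i] (they are
   nonnegative reals inside R[i]).
   l^2(H) is modelled inside the space of all sequences nat -> H by the
   predicate [l2]; the space K (+) l^2(H) inside K * (nat -> H) by [inV].
   A bounded operator on K (+) l^2(H) is a function on K * (nat -> H) that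
   preserves [inV], is linear and bounded on it; operator identities are
   identities of the restrictions to [inV]. *)
From HB Require Import structures.
From mathcomp Require Import all_boot all_order all_algebra.
From mathcomp Require Import all_classical all_reals all_analysis.
From mathcomp Require Export complex.
Export Order.TTheory GRing.Theory Num.Theory.
Export numFieldNormedType.Exports.

Set Implicit Arguments.
Unset Strict Implicit.
Unset Printing Implicit Defensive.

Local Open Scope ring_scope.

Notation "'V[' K , H ]" := (K * (nat -> H))%type (at level 0, format "'V[' K ,  H ]").

Section Defs.
Variable R : realType.
Notation C := (R[i]).

Definition inner_product (E : normedModType C) (ip : E -> E -> C) : Prop :=
  [/\ forall (a : C) (x y z : E), ip (a *: x + y) z = a * ip x z + ip y z,
      forall x y : E, ip y x = (ip x y)^*
    & forall x : E, ip x x = `|x| ^+ 2].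

Variable H K : completeNormedModType C.

Definition l2 (x : nat -> H) : Prop :=
  exists M : C, forall N : nat, \sum_(n < N) `|x n| ^+ 2 <= M.

Definition l2norm2 (x : nat -> H) : C :=
  limn (fun N : nat => \sum_(n < N) `|x n| ^+ 2).

Definition l2norm (x : nat -> H) : C := sqrtC (l2norm2 x).

Definition inV (v : V[K, H]) : Prop := l2 v.2.

Definition vnorm (v : V[K, H]) : C := sqrtC (`|v.1| ^+ 2 + l2norm2 v.2).

Definition bounded_op_K (T : K -> K) : Prop :=
  (forall (a : C) (x y : K), T (a *: x + y) = a *: T x + T y) /\
  exists M : C, forall x : K, `|T x| <= M * `|x|.

Definition bounded_op_l2K (Y : (nat -> H) -> K) : Prop :=
  (forall (a : C) (x y : nat -> H), l2 x -> l2 y ->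
      Y (a *: x + y) = a *: Y x + Y y) /\
  exists M : C, forall x : nat -> H, l2 x -> `|Y x| <= M * l2norm x.

Definition bounded_op_V (F : V[K, H] -> V[K, H]) : Prop :=
  [/\ forall v, inV v -> inV (F v),
      forall (a : C) (v w : V[K, H]), inV v -> inV w ->
         F (a *: v + w) = a *: F v + F w
    & exists M : C, forall v, inV v -> vnorm (F v) <= M * vnorm v].

Definition coisometry (ipK : K -> K -> C) (T : K -> K) : Prop :=
  exists Tstar : K -> K,
    (forall x y : K, ipK (T x) y = ipK x (Tstar y)) /\
    (forall y : K, T (Tstar y) = y).

Definition wshift (w : nat -> C) (x : nat -> H) : nat -> H :=
  fun n => if n is m.+1 then w m *: x m else 0.

Definition beta (w : nat -> C) (n : nat) : C := \prod_(k < n) w k.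

Definition Rop (T : K -> K) (w : nat -> C) (Y : (nat -> H) -> K)
  (v : V[K, H]) : V[K, H] :=
  (T v.1 + Y v.2, wshift w v.2).

Definition power_bounded (F : V[K, H] -> V[K, H]) : Prop :=
  exists M : C, forall (n : nat) (v : V[K, H]), inV v ->
    vnorm (iter n F v) <= M * vnorm v.

Definition similar_to_contraction (F : V[K, H] -> V[K, H]) : Prop :=
  exists L Linv : V[K, H] -> V[K, H],
    [/\ bounded_op_V L, bounded_op_V Linv,
        forall v, inV v -> Linv (L v) = v /\ L (Linv v) = v
      & forall v, inV v -> vnorm (Linv (F (L v))) <= vnorm v].

Definition in_first_H (v : V[K, H]) : Prop :=
  v.1 = 0 /\ forall m : nat, (m != 0)%N -> v.2 m = 0.

Definition beta_quad_near (w : nat -> C) (F G : V[K, H] -> V[K, H]) : Prop :=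
  exists s : C, forall (N : nat) (x : nat -> V[K, H]),
    (forall n, in_first_H (x n)) ->
    vnorm (\sum_(n < N.+1) (beta w n)^-1 *: (iter n F (x n) - iter n G (x n)))
      <= s * sqrtC (\sum_(n < N.+1) vnorm (x n) ^+ 2).

End Defs.

(* Main.v *)
(* The extension R(X) of the coisometry T splits off: writing V = T^*, R(X) is
   similar to T (+) S_w as soon as X = Z S_w - T Z for some bounded Z, and any
   perturbation of X supported on the first coordinate is absorbed by such a Z,
   because B P_0 = W S_w - T W for W = - V B P_0.  The quadratic nearness of
   R(A) to R(0) says exactly that Z (h e_n) := beta(n)^-1 (R(A)^n h e_0)_K
   defines a bounded Z, and then A = Z S_w - T Z; a power bounded weighted shift
   becomes a contraction after a diagonal change of norm.

   Conversely, let R(X) be a contraction for an equivalent Hilbert norm q.  The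
   inclusion of K in K (+) l^2(H) has a bounded left inverse P with
   T P = P R(X), and Z = - P restricted to l^2(H) is the required operator.
   To find P, start with any bounded extension X_0 of the identity of K and
   choose inductively extensions with T X_{n+1} = X_n R(X) and the same bound
   |X_n|^2 <= c^2 q; the Cesaro means of (X_n) intertwine asymptotically, so a
   weak limit of them along an ultrafilter intertwines T and R(X). *)
Require Import Defs.
From HB Require Import structures.
From mathcomp Require Import all_boot all_order all_algebra.
From mathcomp Require Import all_classical all_reals all_analysis.
From mathcomp Require Import complex ring lra.
Import Order.TTheory GRing.Theory Num.Theory.
Import numFieldNormedType.Exports.
Local Open Scope ring_scope.
Local Open Scope complex_scope.
Local Open Scope classical_set_scope.

Set Implicit Arguments.
Unset Strict Implicit.
Unset Printing Implicit Defensive.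

(** * Elementary real inequalities, linear maps and norms with real values *)

Lemma discriminant_le (R : realType) (b h q : R) : 0 <= q ->
  (forall t, 2 * t * b <= h + t ^+ 2 * q) -> b ^+ 2 <= h * q.
Proof.
rewrite le_eqVlt => /predU1P[<-|q0] H.
  (* With no quadratic term the bound is affine in [t]; the chosen [t] turns it into [h + 1 <= h],
     so [b] vanishes. *)
  rewrite mulr0; case: (ltgtP b 0) => [b0|b0|->]; last by rewrite expr0n.
  - have := H ((h + 1) / (2 * b)).
    have -> : 2 * ((h + 1) / (2 * b)) * b = h + 1 by field; rewrite ?lt_eqF// gt_eqF.
    by rewrite mulr0; lra.
  - have := H ((h + 1) / (2 * b)).
    have -> : 2 * ((h + 1) / (2 * b)) * b = h + 1 by field; rewrite ?gt_eqF.
    by rewrite mulr0; lra.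
(* For [q > 0] the bound is sharpest at the vertex [t = b / q]. *)
have := H (b / q).
have -> : 2 * (b / q) * b = 2 * (b ^+ 2 / q) by field; rewrite gt_eqF.
have -> : (b / q) ^+ 2 * q = b ^+ 2 / q by field; rewrite gt_eqF.
by move=> K; have : b ^+ 2 / q <= h by [lra]; rewrite ler_pdivrMr.
Qed.

Lemma ler_norm_sqr (R : realType) (x y : R) :
  0 <= y -> x ^+ 2 <= y ^+ 2 -> `|x| <= y.
Proof.
move=> y0; rewrite -sqrtr_sqr -{2}(ger0_norm y0) -sqrtr_sqr.
exact: ler_wsqrtr.
Qed.

Definition lin (R : realType) (E F : lmodType R[i]) (f : E -> F) : Prop :=
  forall (a : R[i]) (x y : E), f (a *: x + y) = a *: f x + f y.

Section Lin.
Variables (R : realType) (E F : lmodType R[i]) (f : E -> F) (fL : lin f).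

Lemma linD x y : f (x + y) = f x + f y.
Proof. by rewrite -{1}(scale1r x) fL scale1r. Qed.

Lemma lin0 : f 0 = 0.
Proof. by apply: (addrI (f 0)); rewrite -linD !addr0. Qed.

Lemma linZ a x : f (a *: x) = a *: f x.
Proof. by rewrite -{1}(addr0 (a *: x)) fL lin0 addr0. Qed.

Lemma linN x : f (- x) = - f x.
Proof. by rewrite -scaleN1r linZ scaleN1r. Qed.

Lemma linB x y : f (x - y) = f x - f y.
Proof. by rewrite linD linN. Qed.

Lemma lin_sum n (x : 'I_n -> E) : f (\sum_(i < n) x i) = \sum_(i < n) f (x i).
Proof. exact: (big_morph f linD lin0). Qed.

End Lin.

(** Norms take values in [R[i]], whose order is partial; their real part lies in [R], where suprema
    and linear arithmetic are at hand. *)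
Definition nrm (R : realType) (F : normedZmodType R[i]) (x : F) : R :=
  complex.Re `|x|.

Lemma nrmE (R : realType) (F : normedZmodType R[i]) (x : F) :
  `|x| = (nrm x)%:C.
Proof. by rewrite /nrm RRe_real// normr_real. Qed.

Lemma nrm_ge0 (R : realType) (F : normedZmodType R[i]) (x : F) : 0 <= nrm x.
Proof. by rewrite -ler0c -nrmE. Qed.

Lemma nrm_scalar_sqr (R : realType) (a : R[i]) :
  nrm a ^+ 2 = complex.Re a ^+ 2 + complex.Im a ^+ 2.
Proof. by rewrite /nrm normc_def /= sqr_sqrtr ?addr_ge0 ?sqr_ge0. Qed.

(** * Semi-inner products *)

(** Axiomatizes the real part of a complex, possibly degenerate inner product. The field
    [semi_innerJ] records what sesquilinearity says about real parts, so complex linearity can be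
    recovered while all estimates stay in [R]. *)
Record semi_inner (R : realType) (E : lmodType R[i]) (B : E -> E -> R) : Prop := Sip {
  semi_innerDl : forall x y z, B (x + y) z = B x z + B y z;
  semi_innerC : forall x y, B x y = B y x;
  semi_innerZr : forall (t : R) x y, B (t%:C *: x) y = t * B x y;
  semi_innerJ : forall a x y, B (a *: x) y = B x (a^* *: y);
  semi_inner_ge0 : forall x, 0 <= B x x }.

Section Sip.
Variables (R : realType) (E : lmodType R[i]) (B : E -> E -> R) (hB : semi_inner B).
Let sn x : R := Num.sqrt (B x x).

Lemma semi_innerDr x y z : B x (y + z) = B x y + B x z.
Proof. by rewrite semi_innerC// semi_innerDl// !(semi_innerC hB x). Qed.

Lemma semi_innerZrr (t : R) x y : B x (t%:C *: y) = t * B x y.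
Proof. by rewrite semi_innerC// semi_innerZr// (semi_innerC hB x). Qed.

Lemma semi_innerNl x y : B (- x) y = - B x y.
Proof.
have -> : - x = (-1 : R)%:C *: x by rewrite rmorphN1 scaleN1r.
by rewrite semi_innerZr// mulN1r.
Qed.

Lemma semi_innerNr x y : B x (- y) = - B x y.
Proof. by rewrite semi_innerC// semi_innerNl (semi_innerC hB x). Qed.

Lemma semi_inner0l x : B 0 x = 0.
Proof. by rewrite -(scale0r 0) (semi_innerZr hB 0) mul0r. Qed.

Lemma semi_innerBB x y : B (x - y) (x - y) = B x x - 2 * B x y + B y y.
Proof.
rewrite semi_innerDl// !semi_innerDr !semi_innerNl !semi_innerNr.
by rewrite (semi_innerC hB y x); lra.
Qed.

Lemma semi_inner_scale a x : B (a *: x) (a *: x) = (nrm a) ^+ 2 * B x x.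
Proof.
rewrite semi_innerJ// scalerA -semi_innerZrr; congr (B _ (_ *: _)).
rewrite mulrC nrm_scalar_sqr; case: a => u v /=.
by apply/eqP; rewrite eq_complex /=; apply/andP; split; apply/eqP; ring.
Qed.

Lemma CauchySchwarz x y : `|B x y| <= sn x * sn y.
Proof.
apply: ler_norm_sqr; first by rewrite mulr_ge0 ?sqrtr_ge0.
rewrite exprMn !sqr_sqrtr ?semi_inner_ge0//.
apply: (discriminant_le (semi_inner_ge0 hB _)) => t.
have := semi_inner_ge0 hB (x - t%:C *: y).
by rewrite semi_innerBB (semi_innerZr hB) !semi_innerZrr; nra.
Qed.

Lemma sn_ge0 x : 0 <= sn x. Proof. exact: sqrtr_ge0. Qed.

Lemma sn_sqr x : sn x ^+ 2 = B x x. Proof. by rewrite sqr_sqrtr ?semi_inner_ge0. Qed.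

Lemma sn_scale a x : sn (a *: x) = nrm a * sn x.
Proof.
by rewrite /sn semi_inner_scale sqrtrM ?sqr_ge0// sqrtr_sqr ger0_norm ?nrm_ge0.
Qed.

Section Subspace.
Variable S : E -> Prop.
Hypotheses (SD : forall x y, S x -> S y -> S (x + y))
           (SZ : forall a x, S x -> S (a *: x)).
Hypothesis S_ex : exists x, S x.

(** An exact minimizer of [J] may fail to exist without completeness, but a near-minimizer suffices.
    Moving [y] to [y + t z] changes [J] by [t^2 B z z - 2 t (phi z - B y z)], which is at least
    [- eta^2] for every [t]; the discriminant gives the estimate. *)
Lemma approximate_riesz (phi : E -> R) (c : R) : 
  (forall x y, S x -> S y -> phi (x + y) = phi x + phi y) ->
  (forall (t : R) x, S x -> phi (t%:C *: x) = t * phi x) ->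
  (forall x, S x -> `|phi x| <= c * sn x) ->
  forall eta, 0 < eta -> exists2 y, S y &
    forall z, S z -> `|phi z - B y z| <= eta * sn z.
Proof.
move=> phiD phiZ phic eta eta0.
pose J y := B y y - 2 * phi y.
pose A := [set J y | y in [set y | S y]].
(* With [u = sn y], [J y >= u^2 - 2 c u >= - c^2]. *)
have Jlb : lbound A (- c ^+ 2).
  move=> _ [y Sy <-]; rewrite /J -sn_sqr.
  have := phic y Sy; have := ler_norm (phi y); have := sn_ge0 y.
  move: (sn y) (phi y) => u p u0 h1 h2.
  have : 0 <= (u - c) ^+ 2 by exact: sqr_ge0.
  nra.
have hA : has_inf A.
  split; last by exists (- c ^+ 2).
  by case: S_ex => x Sx; exists (J x), x.
have [_ [y Sy <-] Jy] := inf_adherent (exprn_gt0 2 eta0) hA.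
exists y => // z Sz.
apply: ler_norm_sqr; first by apply: mulr_ge0; [exact: ltW | exact: sn_ge0].
rewrite exprMn sn_sqr.
apply: (discriminant_le (semi_inner_ge0 hB _)) => t.
have : inf A <= J (y + t%:C *: z).
  apply: ge_inf; first by exists (- c ^+ 2).
  by exists (y + t%:C *: z) => //; apply: SD => //; apply: SZ.
move: Jy; move: (inf A) => m; rewrite /J phiD//; last exact: SZ.
rewrite phiZ// semi_innerDl// !semi_innerDr !(semi_innerZr hB) !semi_innerZrr.
rewrite (semi_innerC hB z y); nra.
Qed.

End Subspace.
End Sip.

(** * Real-valued norms on complex normed spaces, and completeness *)

Section NormR.
Variables (R : realType) (G : normedModType R[i]).
Implicit Types x y : G.

Lemma nrmZ (a : R[i]) x : nrm (a *: x) = nrm a * nrm x.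
Proof. by apply: complexI; rewrite rmorphM/= -!nrmE normrZ. Qed.

Lemma nrm0 : nrm (0 : G) = 0.
Proof. by rewrite /nrm normr0. Qed.

Lemma nrm_le0 x : nrm x <= 0 -> x = 0.
Proof.
move=> h; apply/eqP; rewrite -normr_eq0 nrmE.
by apply/eqP; congr (_%:C); apply/eqP; rewrite eq_le h nrm_ge0.
Qed.

Lemma nrmN x : nrm (- x) = nrm x. Proof. by rewrite /nrm normrN. Qed.

Lemma nrm_distC x y : nrm (x - y) = nrm (y - x).
Proof. by rewrite -nrmN opprB. Qed.

Lemma ler_nrmD x y : nrm (x + y) <= nrm x + nrm y.
Proof. by rewrite -lecR rmorphD/= -!nrmE ler_normD. Qed.

Lemma ler_nrm_dist z x y : nrm (x - y) <= nrm (x - z) + nrm (z - y).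
Proof. by rewrite (le_trans _ (ler_nrmD _ _))// subrKA. Qed.

Lemma nrm_real (t : R) : nrm (t%:C : R[i]) = `|t|.
Proof. by rewrite /nrm normc_def /= expr0n addr0 sqrtr_sqr. Qed.

End NormR.

Lemma nrm_cauchy (R : realType) (G : completeNormedModType R[i])
    (u : nat -> G) :
  (forall e : R, 0 < e -> exists N, forall n m, (N <= n)%N -> (N <= m)%N ->
     nrm (u n - u m) <= e) ->
  exists g, forall e : R, 0 < e -> exists N, forall n, (N <= n)%N ->
     nrm (g - u n) <= e.
Proof.
move=> uC.
have cu : cvg (u @ \oo).
  apply: cauchy_cvg; apply: cauchy_exP => e e0.
  have [er e1] : exists er, e = er%:C by apply/complex_realP; exact: gtr0_real.
  have er0 : 0 < er by rewrite -ltcR -e1.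
  have [|N HN] := uC (er / 2); first by rewrite divr_gt0.
  exists (u N); exists N => // n /= Nn.
  rewrite -ball_normE /ball_ /= nrmE e1 ltcR.
  by apply: le_lt_trans (HN _ _ _ _) _ => //; rewrite ltr_pdivrMr// ltr_pMr// ltr1n.
exists (lim (u @ \oo)) => e e0.
have /cvgrPdist_lt /(_ e%:C) := cu.
rewrite ltcR => /(_ e0) [N _ HN]; exists N => n Nn.
by have := HN n Nn; rewrite /= nrmE ltcR => /ltW.
Qed.

(** * Norm-preserving extension of bounded operators from a subspace *)

Section Extension.
Variables (R : realType) (E : lmodType R[i]) (B : E -> E -> R) (hB : semi_inner B).
Let sn x : R := Num.sqrt (B x x).
Variable S : E -> Prop.
Hypotheses (SD : forall x y, S x -> S y -> S (x + y))
           (SZ : forall a x, S x -> S (a *: x)) (S_ex : exists x, S x).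

(* [y] represents the functional [phi] on [S] up to [eta]; working with such
   approximate representatives avoids completing the semi-inner product space. *)
Definition represents (phi : E -> R) (eta : R) (y : E) : Prop :=
  S y /\ forall z, S z -> `|phi z - B y z| <= eta * sn z.

(** Both estimates are tested at [z = y - y']: the two errors differ exactly by [B z z], so
    [sn z ^ 2 <= (eta + eta') * sn z]. *)
Lemma represents_close phi eta eta' y y' : 0 <= eta -> 0 <= eta' ->
  represents phi eta y -> represents phi eta' y' -> sn (y - y') <= eta + eta'.
Proof.
move=> e0 e0' [Sy Hy] [Sy' Hy'].
have Sz : S (y - y') by apply: SD => //; rewrite -scaleN1r; exact: SZ.
have : B (y - y') (y - y') = (phi (y - y') - B y' (y - y')) - (phi (y - y') - B y (y - y')).
  by rewrite opprB [RHS]addrC subrKA {1}semi_innerDl// semi_innerNl.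
rewrite -sn_sqr// -/(sn _).
move: (Hy _ Sz) (Hy' _ Sz) (sn_ge0 B (y - y')); rewrite -/(sn _).
move: (sn _) (phi _ - _) (phi _ - _) => n a b; rewrite !ler_norml => ab ab' n0 nE.
rewrite leNgt; apply/negP => lt.
have : (eta + eta') * n < n * n by rewrite ltr_pM2r// (le_lt_trans _ lt)// addr_ge0.
by move: ab ab' nE => /andP[? ?] /andP[? ?]; rewrite expr2; lra.
Qed.

Variables (G : completeNormedModType R[i]) (d : E -> G) (c : R).
Hypotheses (c0 : 0 <= c) (dB : forall x y, S x -> S y -> d (x - y) = d x - d y)
           (dc : forall x, S x -> nrm (d x) <= c * sn x).

(** The vector [g] stands for the value of [d] at the exact representative of [phi] in the
    completion of [S]. Representatives of precision [1/(n+1)] have Cauchy images under [d], and [G]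
    is complete. *)
Lemma represents_limit (phi : E -> R) :
  (forall eta, 0 < eta -> exists y, represents phi eta y) ->
  exists g, forall eta y, 0 <= eta -> represents phi eta y ->
    nrm (g - d y) <= c * eta.
Proof.
move=> ex.
have dclose eta eta' y y' : 0 <= eta -> 0 <= eta' -> represents phi eta y ->
    represents phi eta' y' -> nrm (d y - d y') <= c * (eta + eta').
  move=> e0 e0' ry ry'; have [Sy _] := ry; have [Sy' _] := ry'.
  rewrite -dB// (le_trans (dc _))//.
    by apply: SD => //; rewrite -scaleN1r; exact: SZ.
  by rewrite ler_wpM2l//; exact: represents_close ry ry'.
have p n : 0 < n.+1%:R^-1 :> R by rewrite invr_gt0 ltr0n.
have [y ry] := choice (fun n => ex _ (p n)).
have small (e : R) : 0 < e -> exists N, forall n, (N <= n)%N -> c * n.+1%:R^-1 <= e.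
  move=> e0; exists (Num.truncn (c / e)) => n Nn.
  rewrite ler_pdivrMr ?ltr0n// mulrC -ler_pdivrMr//.
  by rewrite (le_trans (ltW (truncnS_gt _)))// ler_nat ltnS.
have [|g Hg] := @nrm_cauchy _ _ (d \o y).
  move=> e e0; have [|N HN] := small (e / 2); first by rewrite divr_gt0.
  exists N => n m Nn Nm /=.
  apply: le_trans (dclose _ _ _ _ (ltW (p n)) (ltW (p m)) (ry n) (ry m)) _.
  by rewrite mulrDr [leRHS]splitr lerD ?HN.
exists g => eta z eta0 rz; apply/ler_addgt0Pr => e e0.
have e20 : 0 < e / 2 by rewrite divr_gt0.
have [N1 H1] := small _ e20; have [N2 H2] := Hg _ e20.
pose n := maxn N1 N2.
have h1 := H1 n (leq_maxl _ _); have h2 := H2 n (leq_maxr _ _).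
have := ler_nrm_dist (d (y n)) g (d z).
have := dclose _ _ _ _ (ltW (p n)) eta0 (ry n) rz; rewrite mulrDr => h3 h4.
rewrite (le_trans h4)// (le_trans (lerD h2 h3))//.
by rewrite addrA addrC lerD2l [leRHS]splitr lerD2l.
Qed.

End Extension.

(** Dividing by [k + 1] rather than [k] covers [k = 0] as well. *)
Lemma scaled_frac_le (R : realType) (k e : R) :
  0 <= k -> 0 < e -> k * (e / (k + 1)) <= e.
Proof.
move=> k0 e0; rewrite mulrCA; apply: ler_piMr; first exact: ltW.
by rewrite ler_pdivrMr ?mul1r ?lerDl// ltr_wpDl.
Qed.

Lemma nrm_conj (R : realType) (a : R[i]) : nrm a^* = nrm a.
Proof. by rewrite /nrm normcJ. Qed.

Section LinExtension.
Variables (R : realType) (E : lmodType R[i]) (B : E -> E -> R) (hB : semi_inner B).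
Let sn x : R := Num.sqrt (B x x).
Variable S : E -> Prop.
Hypotheses (SD : forall x y, S x -> S y -> S (x + y))
           (SZ : forall a x, S x -> S (a *: x)) (S_ex : exists x, S x).

Lemma represents_lin e e' eta eta' y y' (a : R[i]) :
  represents B S (B e) eta y -> represents B S (B e') eta' y' ->
  represents B S (B (a *: e + e')) (nrm a * eta + eta') (a *: y + y').
Proof.
move=> [Sy Hy] [Sy' Hy']; split=> [|z Sz]; first by apply: SD => //; exact: SZ.
rewrite !semi_innerDl// !(semi_innerJ hB a) opprD addrACA (le_trans (ler_normD _ _))//.
rewrite mulrDl lerD//; last exact: Hy'.
by rewrite (le_trans (Hy _ (SZ _ Sz)))// sn_scale// nrm_conj mulrCA mulrA.
Qed.

Variables (G : completeNormedModType R[i]) (d : E -> G) (c : R).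
Hypotheses (c0 : 0 <= c) (dL : lin d) (dc : forall x, S x -> nrm (d x) <= c * sn x).

(** The extension is [d] composed with the orthogonal projection onto the closure of [S]: an
    approximate representative in [S] of [B e] is an approximate projection of [e]. Projections do
    not increase norms, hence the same constant [c]. *)
Lemma lin_extension : exists D : E -> G,
  [/\ lin D, forall x, S x -> D x = d x & forall x, nrm (D x) <= c * sn x].
Proof.
have ex e eta : 0 < eta -> exists y, represents B S (B e) eta y.
  move=> eta0.
  have [|||y Sy Hy] := @approximate_riesz _ _ _ hB S SD SZ S_ex (B e) (sn e) _ _ _ _ eta0.
  - by move=> x y _ _; exact: semi_innerDr.
  - by move=> t x _; exact: semi_innerZrr.
  - by move=> x _; exact: CauchySchwarz.
  - by exists y.
have [D HD] := choice (fun e => represents_limit hB SD SZ c0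
  (fun x y _ _ => linB dL x y) dc (ex e)).
exists D; split.
- move=> a e e'; apply/subr0_eq/nrm_le0/ler_addgt0Pr => eps eps0; rewrite add0r.
  (* Chosen so that the errors of the three approximations add up to [(k - 1) * (eps / k)]. *)
  pose k := 2 * c * (nrm a + 1) + 1.
  have k0 : 0 < k by rewrite ltr_wpDl// !mulr_ge0// addr_ge0// nrm_ge0.
  have eta0 : 0 < eps / k by rewrite divr_gt0.
  have [y ry] := ex e _ eta0; have [y' ry'] := ex e' _ eta0.
  have eta1 : 0 <= nrm a * (eps / k) + eps / k.
    by apply: addr_ge0; [apply: mulr_ge0; first exact: nrm_ge0|]; exact: ltW.
  have h1 := HD _ _ _ eta1 (represents_lin a ry ry').
  have h2 := HD _ _ _ (ltW eta0) ry; have h3 := HD _ _ _ (ltW eta0) ry'.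
  have h4 : nrm (a *: D e + D e' - d (a *: y + y')) <=
      nrm a * (c * (eps / k)) + c * (eps / k).
    rewrite dL opprD addrACA -scalerBr (le_trans (ler_nrmD _ _))// nrmZ lerD//.
    by rewrite ler_wpM2l// nrm_ge0.
  have := ler_nrm_dist (d (a *: y + y')) (D (a *: e + e')) (a *: D e + D e').
  move/le_trans; apply; rewrite (nrm_distC (d _)); apply: le_trans (lerD h1 h4) _.
  have -> : c * (nrm a * (eps / k) + eps / k) + (nrm a * (c * (eps / k)) + c * (eps / k))
    = (k - 1) * (eps / k) by rewrite /k; ring.
  rewrite mulrBl mul1r mulrC divfK ?gt_eqF//.
  by rewrite lerBlDr lerDl ltW.
(* A vector [x] of [S] represents [B x] with error [0]. *)
- move=> x Sx; apply/subr0_eq/nrm_le0; rewrite -(mulr0 c).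
  by apply: HD => //; split=> // z _; rewrite subrr normr0 mul0r.
- move=> e; apply/ler_addgt0Pr => eps eps0.
  have eta0 : 0 < eps / (2 * c + 1) by rewrite divr_gt0// ltr_wpDl// mulr_ge0.
  have [y ry] := ex e _ eta0.
  have h1 := HD _ _ _ (ltW eta0) ry.
  (* Testing the representative at itself gives [B y y <= B e y + eta * sn y]; Cauchy-Schwarz then
     allows division by [sn y]. *)
  have h2 : sn y <= sn e + eps / (2 * c + 1).
    have [Sy /(_ _ Sy) h] := ry.
    have := sn_ge0 B y; rewrite -/(sn y) le_eqVlt => /predU1P[<-|y0].
      by rewrite addr_ge0 ?sn_ge0// ltW.
    rewrite -(ler_pM2r y0) -expr2 sn_sqr//.
    have := CauchySchwarz hB e y; rewrite mulrDl => /(le_trans (ler_norm _)) h'.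
    rewrite -(subrK (B e y) (B y y)) addrC lerD//.
    by rewrite (le_trans (ler_norm _))// distrC.
  have := dc (proj1 ry); have := ler_nrmD (D e - d y) (d y); rewrite subrK.
  have := ler_wpM2l c0 h2; rewrite mulrDr.
  have : 2 * (c * (eps / (2 * c + 1))) <= eps.
    by rewrite mulrA; apply: scaled_frac_le => //; rewrite mulr_ge0.
  move: h1; lra.
Qed.

End LinExtension.

(** * Real parts of Hilbert space inner products and the Riesz theorem *)

Section Hilbert.
Variables (R : realType) (K : completeNormedModType R[i]).
Variable (ip : K -> K -> R[i]).
Hypothesis hip : inner_product ip.

Definition re_ip x y : R := complex.Re (ip x y).

Lemma ipDl x y z : ip (x + y) z = ip x z + ip y z.
Proof. by case: hip => h _ _; rewrite -{1}(scale1r x) h mul1r. Qed.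

Lemma ip0l z : ip 0 z = 0.
Proof. by apply: (addrI (ip 0 z)); rewrite -ipDl !addr0. Qed.

Lemma ipZl a x z : ip (a *: x) z = a * ip x z.
Proof. by case: hip => h _ _; rewrite -{1}(addr0 (a *: x)) h ip0l addr0. Qed.

Lemma ipC x y : ip y x = (ip x y)^*.
Proof. by case: hip. Qed.

Lemma re_ip_nrm x : re_ip x x = nrm x ^+ 2.
Proof. by case: hip => _ _ h; rewrite /re_ip h nrmE -rmorphXn. Qed.

Lemma re_ip_semi_inner : semi_inner re_ip.
Proof.
split.
- by move=> x y z; rewrite /re_ip ipDl raddfD.
- by move=> x y; rewrite /re_ip (ipC x y); case: (ip x y).
- by move=> t x y; rewrite /re_ip ipZl; case: (ip x y) => u v /=; rewrite mul0r subr0.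
- move=> a x y; rewrite /re_ip (ipC _ x) !ipZl (ipC x y).
  by case: a => a b; case: (ip x y) => u v /=; ring.
- by move=> x; rewrite re_ip_nrm sqr_ge0.
Qed.

Lemma sqrt_re_ip x : Num.sqrt (re_ip x x) = nrm x.
Proof. by rewrite re_ip_nrm sqrtr_sqr ger0_norm ?nrm_ge0. Qed.

Lemma re_ip_le x y : `|re_ip x y| <= nrm x * nrm y.
Proof. by have := CauchySchwarz re_ip_semi_inner x y; rewrite !sqrt_re_ip. Qed.

Lemma re_ip_inj x y : (forall z, re_ip x z = re_ip y z) -> x = y.
Proof.
move=> h; apply/subr0_eq/nrm_le0.
suff : nrm (x - y) ^+ 2 <= 0 by rewrite exprn_even_le0// => /eqP->.
by rewrite -re_ip_nrm (semi_innerDl re_ip_semi_inner) (semi_innerNl re_ip_semi_inner) h subrr.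
Qed.

(** Here [S] is all of [K] and [d] is the identity, so the limit of approximate representatives lies
    in [K] itself. Real linearity of [phi] matches the real form [re_ip]. *)
Lemma riesz (phi : K -> R) (c : R) : (forall x y, phi (x + y) = phi x + phi y) ->
  (forall (t : R) x, phi (t%:C *: x) = t * phi x) ->
  (forall x, `|phi x| <= c * nrm x) -> exists k, forall z, phi z = re_ip k z.
Proof.
move=> phiD phiZ phic.
have ST : exists x : K, (fun=> True) x by exists 0.
have trueD (x y : K) : True -> True -> True by [].
have trueZ (a : R[i]) (x : K) : True -> True by [].
have phic' x : True -> `|phi x| <= c * Num.sqrt (re_ip x x) by rewrite sqrt_re_ip.
have idc x : True -> nrm x <= 1 * Num.sqrt (re_ip x x) by rewrite sqrt_re_ip mul1r.
have ex eta : 0 < eta -> exists y, represents re_ip (fun=> True) phi eta y.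
  move=> e0; have [y _ Hy] := approximate_riesz re_ip_semi_inner trueD trueZ ST
    (fun x y _ _ => phiD x y) (fun t x _ => phiZ t x) phic' e0.
  by exists y.
have [g Hg] := represents_limit re_ip_semi_inner trueD trueZ (d := id) ler01
  (fun x y _ _ => erefl) idc ex.
exists g => z; apply/subr0_eq/normr0_eq0/eqP; rewrite eq_le normr_ge0 andbT.
apply/ler_addgt0Pr => eps eps0; rewrite add0r.
have z0 : 0 < 2 * nrm z + 1 by rewrite ltr_wpDl// mulr_ge0 ?nrm_ge0.
have eta0 : 0 < eps / (2 * nrm z + 1) by rewrite divr_gt0.
have [y ry] := ex _ eta0.
have h1 := Hg _ _ (ltW eta0) ry.
have [_ /(_ z I)] := ry; rewrite sqrt_re_ip => h2.
have := re_ip_le (y - g) z.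
rewrite (semi_innerDl re_ip_semi_inner) (semi_innerNl re_ip_semi_inner) nrm_distC => h3.
have h4 := ler_wpM2r (nrm_ge0 z) h1.
have : 2 * nrm z * (eps / (2 * nrm z + 1)) <= eps.
  by apply: scaled_frac_le => //; rewrite mulr_ge0 ?nrm_ge0.
have := ler_normD (phi z - re_ip y z) (re_ip y z - re_ip g z); rewrite subrKA.
move: h2 h3 h4; rewrite mul1r {h1}.
clear trueD trueZ ST ex Hg ry idc phic phic'; lra.
Qed.

End Hilbert.

(** * Lifting an intertwiner of a coisometry *)

Section WeakLimit.
Variables (R : realType) (U : set_system nat).
Hypothesis (hU : UltraFilter U).

(** The image filter has a cluster point in the compact interval from [- c] to [c]. If a
    neighbourhood of it were not in the filter, its complement would be, and the two would have to
    meet. *)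
Lemma ultralimit (u : nat -> R) (c : R) :
  (forall n, `|u n| <= c) -> exists l : R, u @ U --> l.
Proof.
move=> uc; have FF : ProperFilter (u @ U) by apply: fmap_proper_filter; exact: ultra_proper.
have [|p [_ clp]] := @segment_compact R (- c) c (u @ U) FF.
  apply: (@filterS _ U _ setT) (filterT) => n _ /=.
  by rewrite in_itv /= -ler_norml.
exists p => A Ap /=; have [//|nA] := in_ultra_setVsetC (u @^-1` A) hU.
by have [x []] := clp (~` A) A nA Ap.
Qed.

Variables (K : completeNormedModType R[i]) (ip : K -> K -> R[i]).
Hypothesis hip : inner_product ip.

(** The ultralimits of the products with [z] form a bounded real-linear functional of [z], which the
    Riesz theorem represents by a vector. *)
Lemma weak_limit (u : nat -> K) (b : R) : (forall n, nrm (u n) <= b) ->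
  exists k, forall z, (fun n => re_ip ip (u n) z) @ U --> re_ip ip k z.
Proof.
move=> ub; have FU : ProperFilter U by exact: ultra_proper.
have rS := re_ip_semi_inner hip.
have ubz z n : `|re_ip ip (u n) z| <= b * nrm z.
  by rewrite (le_trans (re_ip_le hip _ _))// ler_wpM2r// nrm_ge0.
have [phi Hphi] := choice (fun z => ultralimit (ubz z)).
have phiD x y : phi (x + y) = phi x + phi y.
  apply: (cvg_unique (@Rhausdorff R) (Hphi (x + y))).
  rewrite (_ : (fun n => _) = (fun n => re_ip ip (u n) x + re_ip ip (u n) y)).
    exact: cvgD.
  by apply/funext => n; exact: semi_innerDr.
have phiZ (t : R) x : phi (t%:C *: x) = t * phi x.
  apply: (cvg_unique (@Rhausdorff R) (Hphi (t%:C *: x))).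
  rewrite (_ : (fun n => _) = (fun n => t * re_ip ip (u n) x)).
    by apply: cvgM => //; exact: cvg_cst.
  by apply/funext => n; exact: semi_innerZrr.
have [|k Hk] := riesz hip phiD phiZ (c := b).
  move=> z; apply: cvgr_to_le (cvg_norm (Hphi z)) _.
  exact: nearW.
by exists k => z; rewrite -Hk.
Qed.

End WeakLimit.

Section Intertwiner.
Variables (R : realType) (E : lmodType R[i]) (B : E -> E -> R) (hB : semi_inner B).
Let sn x : R := Num.sqrt (B x x).
Variables (W : E -> E) (WL : lin W) (WB : forall x, B (W x) (W x) <= B x x).
Variable S : E -> Prop.
Hypotheses (SD : forall x y, S x -> S y -> S (x + y))
           (SZ : forall a x, S x -> S (a *: x)) (S_ex : exists x, S x)
           (SW : forall x, S x -> S (W x)).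
Variables (K : completeNormedModType R[i]) (ip : K -> K -> R[i]).
Hypothesis hip : inner_product ip.
Variables T V : K -> K.
Hypotheses (TL : lin T) (VL : lin V) (TV : forall k, T (V k) = k)
           (adjTV : forall x y, re_ip ip (T x) y = re_ip ip x (V y)).
Variables (J : E -> K) (c : R).
Hypotheses (c0 : 0 <= c) (JL : lin J) (Jc : forall x, S x -> nrm (J x) <= c * sn x)
           (JW : forall x, S x -> T (J x) = J (W x)).

(** In the application [E] is the direct sum, [B] a form for which [W] = R(X) is a contraction, [S]
    the summand [K] and [J] the coordinate in [K]. *)
Definition extends_J (X : E -> K) : Prop :=
  [/\ lin X, forall x, S x -> X x = J x & forall x, nrm (X x) <= c * sn x].

Lemma nrm_V k : nrm (V k) = nrm k.
Proof. by rewrite -!(sqrt_re_ip hip) -adjTV TV. Qed.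

(** [V] is the isometry adjoint to [T], so [V T] is the orthogonal projection onto its range and
    [V (T k)] has the norm of [T k]. *)
Lemma pythagoras_coisometry k :
  nrm (k - V (T k)) ^+ 2 + nrm (T k) ^+ 2 = nrm k ^+ 2.
Proof.
rewrite -!(re_ip_nrm hip) (semi_innerBB (re_ip_semi_inner hip)) -!adjTV TV; ring.
Qed.

Lemma pythagoras_range k l : re_ip ip (V k) (l - V (T l)) = 0.
Proof.
have rS := re_ip_semi_inner hip.
by rewrite (semi_innerC rS) -adjTV (linB TL) TV subrr (semi_inner0l rS).
Qed.

(* [X' = V X W + (1 - V T) D], where [D] extends [(1 - V T) X] from [S]: on [S],
   [|(1 - V T) X x|^2 = |X x|^2 - |T X x|^2 <= c^2 B x x - |X W x|^2], and the
   right-hand side is a semi-inner product since [W] is a contraction. *)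
Lemma one_step_lift X : extends_J X ->
  exists2 X', extends_J X' & forall x, T (X' x) = X (W x).
Proof.
move=> [XL XJ Xc]; have rS := re_ip_semi_inner hip.
pose q x y := c ^+ 2 * B x y - re_ip ip (X (W x)) (X (W y)).
have XWle x : nrm (X (W x)) ^+ 2 <= c ^+ 2 * B x x.
  have h : nrm (X (W x)) <= c * sn x.
    by rewrite (le_trans (Xc _))// ler_wpM2l// ler_wsqrtr.
  rewrite -sn_sqr// -/(sn x) -exprMn ler_sqr// nnegrE ?nrm_ge0//.
  by rewrite mulr_ge0 ?sn_ge0.
have qS : semi_inner q.
  split=> [x y z|x y|t x y|a x y|x]; rewrite /q.
  - by rewrite (semi_innerDl hB) (linD WL) (linD XL) (semi_innerDl rS); ring.
  - by rewrite (semi_innerC hB) (semi_innerC rS).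
  - by rewrite (semi_innerZr hB) (linZ WL) (linZ XL) (semi_innerZr rS); ring.
  - by rewrite (semi_innerJ hB) !(linZ WL) !(linZ XL) (semi_innerJ rS).
  - by rewrite (re_ip_nrm hip) subr_ge0.
pose d x := X x - V (T (X x)).
have dL : lin d.
  by move=> a x y; rewrite /d XL TL VL scalerBr opprD addrACA.
have [|D [DL DJ Dc]] := lin_extension qS SD SZ S_ex ler01 dL.
  move=> x Sx; rewrite mul1r -(ger0_norm (nrm_ge0 (d x))) -sqrtr_sqr ler_wsqrtr//.
  rewrite /q (re_ip_nrm hip).
  have TX : T (X x) = X (W x) by rewrite !XJ//; [exact: JW|exact: SW].
  have := pythagoras_coisometry (X x); rewrite -/(d x) TX.
  have : nrm (X x) ^+ 2 <= c ^+ 2 * B x x.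
    rewrite -sn_sqr// -/(sn x) -exprMn ler_sqr// ?nnegrE ?nrm_ge0//.
    by rewrite mulr_ge0 ?sn_ge0.
  by lra.
exists (fun x => V (X (W x)) + (D x - V (T (D x)))); last first.
  by move=> x; rewrite (linD TL) (linB TL) !TV subrr addr0.
split.
- move=> a x y; rewrite WL XL VL DL TL VL scalerDr scalerBr opprD.
  by rewrite (addrACA (a *: D x)); exact: addrACA.
- move=> x Sx; rewrite DJ// /d (linB TL) TV subrr (lin0 VL) subr0.
  by rewrite !XJ ?JW 1?addrC ?subrK//; exact: SW.
- move=> x.
  (* The two summands are orthogonal, so the squared norm is [|X W x|^2 + |D x|^2 - |T D x|^2], and
     [|D x|^2 <= q x x] cancels the first term. *)
  suff : nrm (V (X (W x)) + (D x - V (T (D x)))) ^+ 2 <= (c * sn x) ^+ 2.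
    by rewrite ler_sqr// nnegrE ?nrm_ge0// mulr_ge0 ?sn_ge0.
  rewrite -(re_ip_nrm hip) (semi_innerDl rS) !(semi_innerDr rS _ (V _)) pythagoras_range.
  rewrite (semi_innerC rS _ (V _)) pythagoras_range addr0 add0r !(re_ip_nrm hip) nrm_V.
  have := pythagoras_coisometry (D x).
  have : nrm (D x) ^+ 2 <= q x x.
    rewrite -(sn_sqr qS) ler_sqr ?nnegrE ?nrm_ge0 ?sn_ge0//.
    by have := Dc x; rewrite mul1r.
  rewrite /q (re_ip_nrm hip) exprMn sn_sqr//; have := sqr_ge0 (nrm (T (D x))); lra.
Qed.

Lemma intertwining_extension :
  exists2 X, extends_J X & forall x, T (X x) = X (W x).
Proof.
have rS := re_ip_semi_inner hip.
have [X0 X0J] := lin_extension hB SD SZ S_ex c0 JL Jc.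
(* The lift is made a total function in order to be iterated; where [extends_J] fails its value is a
   dummy. *)
have /choice[F HF] : forall X, exists X', extends_J X ->
    extends_J X' /\ forall x, T (X' x) = X (W x).
  move=> X; have [/one_step_lift[X' hX' TX']|nX] := pselect (extends_J X).
    by exists X'.
  by exists X.
pose X n := iter n F X0.
have XJ n : extends_J (X n) by elim: n => //= n /HF[].
have TX n x : T (X n.+1 x) = X n (W x) by have [_ ->] := HF _ (XJ n).
pose a N : R := N.+1%:R^-1.
have a0 N : 0 < a N by rewrite invr_gt0.
pose Y N x := (a N)%:C *: \sum_(n < N.+1) X n x.
have YL N : lin (Y N).
  move=> b x y; rewrite /Y scalerA mulrC -scalerA -scalerDr; congr (_ *: _).
  rewrite scaler_sumr -big_split /=; apply: eq_bigr => n _.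
  by have [L _ _] := XJ n; exact: L.
have aN N (k : K) : (a N)%:C *: \sum_(n < N.+1) k = k.
  rewrite sumr_const card_ord -scaler_nat scalerA.
  by rewrite -(rmorph_nat (real_complex R)) -rmorphM mulVf ?rmorph1 ?scale1r// pnatr_eq0.
have YJ N x : S x -> Y N x = J x.
  move=> Sx; rewrite -[RHS](aN N) /Y; congr (_ *: _).
  by apply: eq_bigr => n _; have [_ /(_ x Sx)] := XJ n.
have Yc N x : nrm (Y N x) <= c * sn x.
  rewrite nrmZ nrm_real gtr0_norm// mulrC /a ler_pdivrMr ?ltr0n//.
  elim: N.+1 => [|n IH]; first by rewrite big_ord0 nrm0 mulr0.
  rewrite big_ord_recr /= (le_trans (ler_nrmD _ _))// -natr1 mulrDr mulr1 lerD//.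
  by have [_ _] := XJ n.
(* Since [T X_{n+1} = X_n W], the difference telescopes to [T X_0 - X_N W], divided by the number of
   terms. *)
have TY N x : nrm (T (Y N x) - Y N (W x)) <= 2 * (c * sn x) * a N.
  rewrite (linZ TL) -scalerBr nrmZ nrm_real gtr0_norm// mulrC ler_pM2r//.
  have -> : T (\sum_(n < N.+1) X n x) - \sum_(n < N.+1) X n (W x) =
      T (X0 x) - X N (W x).
    rewrite (lin_sum TL) big_ord_recl [X in _ - X]big_ord_recr /=.
    rewrite [X in _ - X]addrC opprD addrACA [X in _ + X](_ : _ = 0) ?addr0//.
    by apply/eqP; rewrite subr_eq0; apply/eqP/eq_bigr => n _; exact: TX.
  rewrite (le_trans (ler_nrmD _ _))// nrmN.
  have TX0 : nrm (T (X0 x)) <= nrm (X0 x).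
    rewrite -ler_sqr ?nnegrE ?nrm_ge0// -(pythagoras_coisometry (X0 x)).
    by rewrite lerDr sqr_ge0.
  have [_ _ /(_ x) X0c] := X0J; have [_ _ /(_ (W x)) XNc] := XJ N.
  have : c * sn (W x) <= c * sn x by rewrite ler_wpM2l// ler_wsqrtr.
  by move: TX0 X0c XNc; rewrite -/(sn x) -/(sn (W x)); lra.
(* [U] refines the filter of cofinal segments, so errors tending to [0] also vanish along [U]. *)
have [U [hU UN]] := ultraFilterLemma eventually_filter.
have FU : ProperFilter U by exact: ultra_proper.
have /choice[Z HZ] := fun x => weak_limit hU hip (Yc ^~ x).
exists Z.
  split.
  - move=> b x y; apply: (re_ip_inj hip) => z.
    apply: (cvg_unique (@Rhausdorff R) (HZ _ z)).
    rewrite (semi_innerDl rS) (semi_innerJ rS).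
    rewrite (_ : (fun n => _) = (fun n => re_ip ip (Y n x) (b^* *: z) + re_ip ip (Y n y) z)).
      exact: cvgD.
    by apply/funext => n; rewrite YL (semi_innerDl rS) (semi_innerJ rS).
  - move=> x Sx; apply: (re_ip_inj hip) => z.
    apply: (cvg_unique (@Rhausdorff R) (HZ _ z)).
    rewrite (_ : (fun n => _) = (fun=> re_ip ip (J x) z)); first exact: cvg_cst.
    by apply/funext => n; rewrite YJ.
  (* [|Z x|^2] is the limit of the products of [Y n x] with [Z x], each at most
     [c * sn x * |Z x|]. *)
  - move=> x; have := nrm_ge0 (Z x); rewrite le_eqVlt => /predU1P[<-|z0].
      by rewrite mulr_ge0 ?sn_ge0.
    rewrite -(ler_pM2r z0) -expr2 -(re_ip_nrm hip).
    apply: cvgr_to_le (HZ x (Z x)) _; apply: nearW => n.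
    rewrite (le_trans (ler_norm _))// (le_trans (re_ip_le hip _ _))//.
    by rewrite ler_wpM2r// nrm_ge0.
(* Moving [T] onto [z] as [V] lets weak convergence be used on both sides; only the telescoped error
   separates them. *)
move=> x; apply: (re_ip_inj hip) => z; rewrite adjTV.
apply: (cvg_unique (@Rhausdorff R) (HZ _ _)).
rewrite -[re_ip ip (Z (W x)) z]addr0.
rewrite (_ : (fun n => _) = (fun n => re_ip ip (Y n (W x)) z +
  re_ip ip (T (Y n x) - Y n (W x)) z)).
  apply: cvgD => //; apply/cvgr0Pnorm_le => e e0; apply: UN.
  pose k := 2 * (c * sn x) * nrm z.
  exists (Num.truncn (k / e)) => // N /= Nn.
  rewrite (le_trans (re_ip_le hip _ _))// (le_trans (ler_wpM2r (nrm_ge0 z) (TY N x)))//.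
  rewrite mulrAC -/k ler_pdivrMr ?ltr0n// mulrC -ler_pdivrMr//.
  by rewrite (le_trans (ltW (truncnS_gt _)))// ler_nat ltnS.
by apply/funext => n; rewrite -(semi_innerDl rS) addrC subrK adjTV.
Qed.

End Intertwiner.

(** * Square-summable sequences *)

Lemma sqrtC_real (R : realType) (a : R) : 0 <= a ->
  sqrtC (a%:C : R[i]) = (Num.sqrt a)%:C.
Proof.
move=> a0; rewrite -{1}(sqr_sqrtr a0) rmorphXn /= sqrCK//.
by rewrite ler0c sqrtr_ge0.
Qed.

(** Bounds in the definitions use a complex constant [M]; taking moduli replaces it by a nonnegative
    real one. *)
Lemma real_bound (R : realType) (M : R[i]) (a b : R) : 0 <= a -> 0 <= b ->
  a%:C <= M * b%:C -> a <= nrm M * b.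
Proof.
move=> a0 b0 h; rewrite -lecR rmorphM/= -nrmE -(ger0_norm (x := b%:C)) ?ler0c//.
by rewrite -normrM ger0_norm// (le_trans _ h)// ler0c.
Qed.

Section NrmLimits.
Variables (R : realType) (G : normedModType R[i]).
Implicit Types (u : nat -> G) (g : G).

Lemma nrm_cvgP u g : (forall e : R, 0 < e -> exists N, forall n, (N <= n)%N ->
  nrm (g - u n) <= e) <-> u @ \oo --> g.
Proof.
split=> [h|/cvgrPdist_le h].
  apply/cvgrPdist_le => e e0.
  have [er e1] : exists er, e = er%:C by apply/complex_realP; exact: gtr0_real.
  have er0 : 0 < er by rewrite -ltcR -e1.
  have [N HN] := h _ er0; exists N => // n Nn.
  by rewrite nrmE e1 lecR; exact: HN.
move=> e e0; have [|N _ HN] := h e%:C; first by rewrite ltcR.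
by exists N => n Nn; have := HN n Nn; rewrite /= nrmE lecR.
Qed.

Lemma nrm_lim_le u g (c : R) : u @ \oo --> g -> (forall n, nrm (u n) <= c) -> nrm g <= c.
Proof.
move=> /nrm_cvgP ug uc; apply/ler_addgt0Pr => e e0.
have [N /(_ N (leqnn _)) HN] := ug _ e0.
rewrite -(subrK (u N) g) (le_trans (ler_nrmD _ _))// addrC lerD//.
Qed.

Lemma lim_uniq u g g' : u @ \oo --> g -> u @ \oo --> g' -> g = g'.
Proof. exact: (cvg_unique (@norm_hausdorff _ G)). Qed.

End NrmLimits.

Section L2.
Variables (R : realType) (H : completeNormedModType R[i]).
Implicit Types x y : nat -> H.

Definition psum2 x N : R := \sum_(n < N) nrm (x n) ^+ 2.

Definition norm2 x : R := complex.Re (l2norm2 x).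

Lemma psum2_complex x N : \sum_(n < N) `|x n| ^+ 2 = (psum2 x N)%:C.
Proof.
rewrite /psum2 rmorph_sum; apply: eq_bigr => n _; rewrite nrmE.
by rewrite rmorphXn.
Qed.

Lemma psum2_nd x : nondecreasing_seq (psum2 x).
Proof.
apply/nondecreasing_seqP => n; rewrite /psum2 big_ord_recr /= lerDl sqr_ge0//.
Qed.

Lemma psum2_ge0 x N : 0 <= psum2 x N.
Proof. by apply: sumr_ge0 => n _; rewrite sqr_ge0. Qed.

Lemma l2P x : l2 x <-> exists c : R, forall N, psum2 x N <= c.
Proof.
split=> [[M HM]|[c Hc]]; last by exists c%:C => N; rewrite psum2_complex lecR.
exists (complex.Re M) => N; have := HM N.
by rewrite psum2_complex lecE => /andP[].
Qed.

Lemma psum2_is_cvg x : l2 x -> cvgn (psum2 x).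
Proof.
move=> /l2P[c Hc].
by apply: nondecreasing_is_cvgn; [exact: psum2_nd|exists c => _ [N _ <-]].
Qed.

Lemma l2norm2_lim x : l2 x -> l2norm2 x = (limn (psum2 x))%:C.
Proof.
move=> /psum2_is_cvg/cvgrPdist_le cv.
pose F : numFieldType := R[i].
have h : (fun N => \sum_(n < N) `|x n| ^+ 2 : F) @ \oo --> ((limn (psum2 x))%:C : F).
  apply/(@nrm_cvgP R F) => e e0; have [N _ HN] := cv _ e0; exists N => n Nn.
  by rewrite psum2_complex -rmorphB nrm_real; exact: HN.
exact: (cvg_lim (@norm_hausdorff F F) h).
Qed.

Lemma psum2_cvg x : l2 x -> psum2 x @ \oo --> norm2 x.
Proof. by move=> lx; rewrite /norm2 l2norm2_lim//; exact: psum2_is_cvg. Qed.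

Lemma l2norm2E x : l2 x -> l2norm2 x = (norm2 x)%:C.
Proof. by move=> lx; rewrite /norm2 l2norm2_lim. Qed.

Lemma psum2_le x N : l2 x -> psum2 x N <= norm2 x.
Proof.
move=> lx; have cv := psum2_cvg lx.
rewrite -(cvg_lim (@Rhausdorff R) cv).
by apply: nondecreasing_cvgn_le; [exact: psum2_nd|exact: cvgP cv].
Qed.

Lemma norm2_le x c : l2 x -> (forall N, psum2 x N <= c) -> norm2 x <= c.
Proof. by move=> /psum2_cvg cv h; apply: cvgr_to_le cv _; exact: nearW. Qed.

Lemma norm2_ge0 x : l2 x -> 0 <= norm2 x.
Proof. by move=> /(psum2_le 0); exact: le_trans (psum2_ge0 x 0). Qed.

Lemma psum2Z a x N : psum2 (a *: x) N = nrm a ^+ 2 * psum2 x N.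
Proof.
by rewrite /psum2 mulr_sumr; apply: eq_bigr => n _; rewrite nrmZ exprMn.
Qed.

Lemma psum2D_le x y N : psum2 (x + y) N <= 2 * psum2 x N + 2 * psum2 y N.
Proof.
rewrite /psum2 !mulr_sumr -big_split; apply: ler_sum => n _ /=.
have h := ler_nrmD (x n) (y n).
have : nrm (x n + y n) ^+ 2 <= (nrm (x n) + nrm (y n)) ^+ 2.
  by rewrite ler_sqr ?nnegrE ?addr_ge0 ?nrm_ge0.
have := sqr_ge0 (nrm (x n) - nrm (y n)); nra.
Qed.

Lemma l2Z a x : l2 x -> l2 (a *: x).
Proof.
move=> lx; apply/l2P; exists (nrm a ^+ 2 * norm2 x) => N.
by rewrite psum2Z ler_wpM2l ?sqr_ge0// psum2_le.
Qed.

Lemma l2D x y : l2 x -> l2 y -> l2 (x + y).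
Proof.
move=> lx ly; apply/l2P; exists (2 * norm2 x + 2 * norm2 y) => N.
by rewrite (le_trans (psum2D_le _ _ _))// lerD// ler_wpM2l// psum2_le.
Qed.

Lemma l2B x y : l2 x -> l2 y -> l2 (x - y).
Proof. by move=> lx ly; rewrite -scaleN1r; exact/l2D/l2Z. Qed.

Lemma l2_0 : l2 (0 : nat -> H).
Proof.
by apply/l2P; exists 0 => N; rewrite /psum2 big1// => n _; rewrite nrm0 expr0n.
Qed.

Lemma norm2_0 : norm2 (0 : nat -> H) = 0.
Proof.
apply/eqP; rewrite eq_le norm2_ge0 ?andbT; last exact: l2_0.
apply: norm2_le => [|N]; first exact: l2_0.
by rewrite /psum2 big1// => n _; rewrite nrm0 expr0n.
Qed.

Lemma l2normE x : l2 x -> l2norm x = (Num.sqrt (norm2 x))%:C.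
Proof. by move=> lx; rewrite /l2norm l2norm2E// sqrtC_real// norm2_ge0. Qed.

Definition single (h : H) (n : nat) : nat -> H := fun m => if m == n then h else 0.

Definition trunc (N : nat) x : nat -> H := fun n => if (n < N)%N then x n else 0.

Lemma truncE N x : trunc N x = \sum_(n < N) single (x n) n.
Proof.
apply/funext => m; rewrite fct_sumE /trunc /single.
case: ifP => mN.
  rewrite (bigD1 (Ordinal mN)) //= eqxx big1 ?addr0// => i.
  by rewrite -val_eqE /= eq_sym => /negPf ->.
rewrite big1// => i _; case: eqP => // mi.
by move: mN; rewrite mi ltn_ord.
Qed.

Lemma psum2_trunc N x M : psum2 (trunc N x) M <= psum2 x N.
Proof.
(* Summing up to [N + M] lets the sum be split at [N] without comparing [N] and [M]. *)
apply: le_trans (_ : psum2 (trunc N x) (N + M) <= _); first by apply: psum2_nd; rewrite leq_addl.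
rewrite /psum2 big_split_ord /= [X in _ + X]big1 ?addr0 => [|i _]; last first.
  by rewrite /trunc ltnNge leq_addr /= nrm0 expr0n.
by apply: ler_sum => i _; rewrite /trunc ltn_ord.
Qed.

Lemma l2_trunc N x : l2 (trunc N x).
Proof. by apply/l2P; exists (psum2 x N) => M; exact: psum2_trunc. Qed.

Lemma norm2_trunc N x : norm2 (trunc N x) <= psum2 x N.
Proof. by apply: norm2_le => [|M]; [exact: l2_trunc|exact: psum2_trunc]. Qed.

Lemma single_trunc h n : single h n = trunc n.+1 (single h n).
Proof.
apply/funext => m; rewrite /trunc /single.
by case: eqP => [->|_]; [rewrite ltnSn|rewrite if_same].
Qed.

Lemma psum2_single h n : psum2 (single h n) n.+1 = nrm h ^+ 2.
Proof.
rewrite /psum2 big_ord_recr /= /single eqxx big1 ?add0r// => i _.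
by rewrite ltn_eqF// nrm0 expr0n.
Qed.

Lemma l2_single h n : l2 (single h n).
Proof. by rewrite single_trunc; exact: l2_trunc. Qed.

Lemma norm2_single h n : norm2 (single h n) = nrm h ^+ 2.
Proof.
apply/eqP; rewrite eq_le -(psum2_single h n) psum2_le ?andbT; last exact: l2_single.
by rewrite {1}single_trunc norm2_trunc.
Qed.

Lemma singleZD a h k n : single (a *: h + k) n = a *: single h n + single k n.
Proof.
apply/funext => m; rewrite /single.
rewrite -[RHS]/(a *: (if m == n then h else 0) + (if m == n then k else 0)).
by case: ifP => // _; rewrite scaler0 addr0.
Qed.

Lemma single0 n : single 0 n = 0.
Proof. by apply/funext => m; rewrite /single; case: ifP. Qed.

Lemma single_head x : (forall m, (m != 0)%N -> x m = 0) -> x = single (x 0%N) 0.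
Proof. by move=> h; apply/funext => m; rewrite /single; case: eqP => [->//|/eqP/h]. Qed.

Lemma psum2_tail x N M : psum2 (x - trunc N x) M + psum2 x N <= psum2 x (N + M).
Proof.
apply: le_trans (_ : psum2 (x - trunc N x) (N + M) + psum2 x N <= _).
  by rewrite lerD2r; apply: psum2_nd; rewrite leq_addl.
rewrite /psum2 big_split_ord [X in _ <= X]big_split_ord /= big1 => [|i _].
  rewrite add0r [leLHS]addrC lerD2l; apply: ler_sum => i _.
  by rewrite -[(x - _) _]/(x _ - trunc N x _) /trunc ltnNge leq_addr subr0.
by rewrite -[(x - _) _]/(x _ - trunc N x _) /trunc ltn_ord subrr nrm0 expr0n.
Qed.

Lemma norm2_tail x N : l2 x -> norm2 (x - trunc N x) <= norm2 x - psum2 x N.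
Proof.
move=> lx; apply: norm2_le => [|M]; first by apply: l2B => //; exact: l2_trunc.
by rewrite lerBrDr (le_trans (psum2_tail _ _ _))// psum2_le.
Qed.

Lemma tail_small x (e : R) : l2 x -> 0 < e ->
  exists N0, forall N, (N0 <= N)%N -> Num.sqrt (norm2 (x - trunc N x)) <= e.
Proof.
move=> lx e0; have /cvgrPdist_le/(_ (e ^+ 2)) := psum2_cvg lx.
rewrite exprn_gt0// => /(_ isT)[N0 _ H0]; exists N0 => N /H0 /= hN.
rewrite -(ger0_norm (ltW e0)) -sqrtr_sqr ler_wsqrtr//.
by rewrite (le_trans (norm2_tail _ lx))// (le_trans (ler_norm _)).
Qed.

End L2.

(** * The real inner product of square-summable sequences *)

Section L2inner.
Variables (R : realType) (H : completeNormedModType R[i]) (ip : H -> H -> R[i]).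
Hypothesis hip : inner_product ip.
Implicit Types x y z : nat -> H.

Definition partial_ip x y N : R := \sum_(n < N) re_ip ip (x n) (y n).

Definition re_ip2 x y : R := limn (partial_ip x y).

(** Expresses partial sums of inner products through partial sums of squares, whose convergence is
    known. *)
Lemma polarization (h k : H) :
  re_ip ip h k = 2^-1 * (nrm (h + k) ^+ 2 - nrm h ^+ 2 - nrm k ^+ 2).
Proof.
have rS := re_ip_semi_inner hip; rewrite -!(re_ip_nrm hip) (semi_innerDl rS) !(semi_innerDr rS).
by rewrite (semi_innerC rS k h); lra.
Qed.

Lemma partial_ip_cvg x y : l2 x -> l2 y -> partial_ip x y @ \oo --> re_ip2 x y.
Proof.
move=> lx ly; suff : cvgn (partial_ip x y) by [].
have -> : partial_ip x y = (fun N => 2^-1 * (psum2 (x + y) N - psum2 x N - psum2 y N)).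
  apply/funext => N; rewrite /psum2 /partial_ip -!sumrB mulr_sumr.
  by apply: eq_bigr => n _; exact: polarization.
apply/cvg_ex; exists (2^-1 * (norm2 (x + y) - norm2 x - norm2 y)).
by apply: cvgM; [exact: cvg_cst|]; apply: cvgB; [apply: cvgB|]; apply: psum2_cvg => //; exact: l2D.
Qed.

Lemma re_ip2_eq x y l : l2 x -> l2 y -> partial_ip x y @ \oo --> l -> re_ip2 x y = l.
Proof. by move=> lx ly; exact: (cvg_unique (@Rhausdorff R) (partial_ip_cvg lx ly)). Qed.

Lemma re_ip2Dl x y z : l2 x -> l2 y -> l2 z -> re_ip2 (x + y) z = re_ip2 x z + re_ip2 y z.
Proof.
move=> lx ly lz; apply: re_ip2_eq => //; first exact: l2D.
have -> : partial_ip (x + y) z = (fun N => partial_ip x z N + partial_ip y z N).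
  apply/funext => N; rewrite /partial_ip -big_split; apply: eq_bigr => n _.
  exact: (semi_innerDl (re_ip_semi_inner hip)).
by apply: cvgD; apply: partial_ip_cvg.
Qed.

Lemma re_ip2C x y : re_ip2 x y = re_ip2 y x.
Proof.
rewrite /re_ip2 (_ : partial_ip x y = partial_ip y x)//; apply/funext => N.
by apply: eq_bigr => n _; exact: (semi_innerC (re_ip_semi_inner hip)).
Qed.

Lemma re_ip2Z (t : R) x y : l2 x -> l2 y -> re_ip2 (t%:C *: x) y = t * re_ip2 x y.
Proof.
move=> lx ly; apply: re_ip2_eq => //; first exact: l2Z.
have -> : partial_ip (t%:C *: x) y = (fun N => t * partial_ip x y N).
  apply/funext => N; rewrite /partial_ip mulr_sumr; apply: eq_bigr => n _.
  exact: (semi_innerZr (re_ip_semi_inner hip)).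
by apply: cvgM; [exact: cvg_cst|exact: partial_ip_cvg].
Qed.

Lemma re_ip2J a x y : re_ip2 (a *: x) y = re_ip2 x (a^* *: y).
Proof.
rewrite /re_ip2 (_ : partial_ip (a *: x) y = partial_ip x (a^* *: y))//; apply/funext => N.
by apply: eq_bigr => n _; exact: (semi_innerJ (re_ip_semi_inner hip)).
Qed.

Lemma re_ip2_norm2 x : l2 x -> re_ip2 x x = norm2 x.
Proof.
move=> lx; have pE : partial_ip x x = psum2 x.
  by apply/funext => N; apply: eq_bigr => n _; exact: re_ip_nrm.
by apply: (re_ip2_eq lx lx); rewrite pE; exact: psum2_cvg.
Qed.

End L2inner.

(** * The norm of the direct sum and bounded operators on it *)

Section Vspace.
Variables (R : realType) (H K : completeNormedModType R[i]).
Implicit Types v : V[K, H].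

Definition normV v : R := Num.sqrt (nrm v.1 ^+ 2 + norm2 v.2).

Lemma normV_sqr v : inV v -> normV v ^+ 2 = nrm v.1 ^+ 2 + norm2 v.2.
Proof. by move=> hv; rewrite sqr_sqrtr// addr_ge0 ?sqr_ge0 ?norm2_ge0. Qed.

Lemma normV_ge0 v : 0 <= normV v. Proof. exact: sqrtr_ge0. Qed.

Lemma vnormE v : inV v -> vnorm v = (normV v)%:C.
Proof.
move=> hv; rewrite /vnorm l2norm2E// nrmE -rmorphXn -rmorphD sqrtC_real//.
by rewrite addr_ge0 ?sqr_ge0 ?norm2_ge0.
Qed.

Lemma nrm_le_normV v : inV v -> nrm v.1 <= normV v.
Proof.
move=> hv; rewrite -[nrm _]ger0_norm ?nrm_ge0// -sqrtr_sqr ler_wsqrtr//.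
by rewrite lerDl norm2_ge0.
Qed.

Lemma norm2_le_normV v : inV v -> Num.sqrt (norm2 v.2) <= normV v.
Proof. by move=> hv; rewrite ler_wsqrtr// lerDr sqr_ge0. Qed.

Lemma normV_le v : inV v -> normV v <= nrm v.1 + Num.sqrt (norm2 v.2).
Proof.
move=> hv; have s0 := sqrtr_ge0 (norm2 v.2); have n0 := nrm_ge0 v.1.
rewrite -ler_sqr ?nnegrE ?normV_ge0 ?addr_ge0// normV_sqr// -{1}(sqr_sqrtr (norm2_ge0 hv)).
have := mulr_ge0 n0 s0; lra.
Qed.

Lemma opl2_bound (Y : (nat -> H) -> K) : bounded_op_l2K Y ->
  exists2 c : R, 0 <= c & forall x, l2 x -> nrm (Y x) <= c * Num.sqrt (norm2 x).
Proof.
move=> [_ [M HM]]; exists (nrm M) => [|x lx]; first exact: nrm_ge0.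
apply: real_bound; rewrite ?nrm_ge0 ?sqrtr_ge0//.
by rewrite -nrmE -l2normE// HM.
Qed.

Lemma mk_opl2 (Y : (nat -> H) -> K) (c : R) :
  (forall a x y, l2 x -> l2 y -> Y (a *: x + y) = a *: Y x + Y y) ->
  (forall x, l2 x -> nrm (Y x) <= c * Num.sqrt (norm2 x)) -> bounded_op_l2K Y.
Proof.
move=> YL Yc; split=> //; exists c%:C => x lx.
by rewrite l2normE// nrmE -rmorphM lecR Yc.
Qed.

Lemma opV_bound (F : V[K, H] -> V[K, H]) : bounded_op_V F ->
  exists2 c : R, 0 <= c & forall v, inV v -> normV (F v) <= c * normV v.
Proof.
move=> [FV _ [M HM]]; exists (nrm M) => [|v hv]; first exact: nrm_ge0.
apply: real_bound; rewrite ?normV_ge0//.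
by rewrite -!vnormE//; [exact: HM|exact: FV].
Qed.

Lemma mk_opV (F : V[K, H] -> V[K, H]) (c : R) :
  (forall v, inV v -> inV (F v)) ->
  (forall a v w, inV v -> inV w -> F (a *: v + w) = a *: F v + F w) ->
  (forall v, inV v -> normV (F v) <= c * normV v) -> bounded_op_V F.
Proof.
move=> FV FL Fc; split=> //; exists c%:C => v hv.
by rewrite !vnormE//; [rewrite -rmorphM lecR Fc|exact: FV].
Qed.

Variable Y : (nat -> H) -> K.
Hypothesis hY : bounded_op_l2K Y.

Lemma opl2D x y : l2 x -> l2 y -> Y (x + y) = Y x + Y y.
Proof. by case: hY => h _ lx ly; rewrite -{1}(scale1r x) h// scale1r. Qed.

Lemma opl2_0 : Y 0 = 0.
Proof.
apply: (addrI (Y 0)); rewrite -opl2D ?addr0//; exact: l2_0.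
Qed.

Lemma opl2Z a x : l2 x -> Y (a *: x) = a *: Y x.
Proof.
case: hY => h _ lx; rewrite -{1}(addr0 (a *: x)) h//; last exact: l2_0.
by rewrite opl2_0 addr0.
Qed.

Lemma opl2B x y : l2 x -> l2 y -> Y (x - y) = Y x - Y y.
Proof.
move=> lx ly; rewrite -[- y]scaleN1r opl2D//; last exact: l2Z.
by rewrite opl2Z// scaleN1r.
Qed.

Lemma opl2_trunc N x : Y (trunc N x) = \sum_(n < N) Y (single (x n) n).
Proof.
rewrite truncE; elim: N => [|N IH]; first by rewrite !big_ord0 opl2_0.
rewrite !big_ord_recr /= opl2D ?IH//; last exact: l2_single.
by rewrite -truncE; exact: l2_trunc.
Qed.

(** The tails of [x] tend to [0] in norm and [Y] is bounded. A bounded operator is thus determined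
    by its values on the sequences [single h n]. *)
Lemma opl2_series x : l2 x -> (fun N => Y (trunc N x)) @ \oo --> Y x.
Proof.
move=> lx; have [c c0 Yc] := opl2_bound hY; apply/nrm_cvgP => e e0.
have [|N0 H0] := @tail_small _ _ x (e / (c + 1)) lx.
  by rewrite divr_gt0// ltr_wpDl.
exists N0 => N /H0 h; have lt := l2_trunc N x.
rewrite -opl2B// (le_trans (Yc _ _))//; first exact: l2B.
by rewrite (le_trans (ler_wpM2l c0 h))// scaled_frac_le.
Qed.

End Vspace.

Lemma opl2_ext (R : realType) (H K : completeNormedModType R[i])
  (Y Y' : (nat -> H) -> K) : bounded_op_l2K Y -> bounded_op_l2K Y' ->
  (forall h n, Y (single h n) = Y' (single h n)) ->
  forall x, l2 x -> Y x = Y' x.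
Proof.
move=> hY hY' YY' x lx; have h := opl2_series hY lx.
apply: (lim_uniq h).
rewrite (_ : (fun N => _) = (fun N => Y' (trunc N x))); first exact: opl2_series.
by apply/funext => N; rewrite !opl2_trunc//; apply: eq_bigr.
Qed.

(** * The direct sum as a module, with inner products pulled back along operators *)

Section Subtype.
Variables (R : realType) (H K : completeNormedModType R[i]).

Definition Vl2_pred : {pred V[K, H]} := fun v => `[< inV v >].

Lemma Vl2_submod : submod_closed Vl2_pred.
Proof.
split; first by apply/asboolP; exact: l2_0.
move=> a v w /asboolP hv /asboolP hw; apply/asboolP.
by apply: l2D => //; exact: l2Z.
Qed.

HB.instance Definition _ := GRing.isSubmodClosed.Build R[i] V[K, H] Vl2_pred Vl2_submod.

(** The extension results concern forms on a whole module, so the square-summable pairs are packaged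
    as one. *)
Record Vl2 := MkVl2 { vl2 :> V[K, H]; _ : vl2 \in Vl2_pred }.
HB.instance Definition _ := [isSub for vl2].
HB.instance Definition _ := [Choice of Vl2 by <:].
HB.instance Definition _ := [SubChoice_isSubLmodule of Vl2 by <:].

Lemma Vl2P (u : Vl2) : inV (vl2 u).
Proof. by case: u => v /= /asboolP. Qed.

Definition toVl2 v (hv : inV v) : Vl2 := MkVl2 (introT (asboolP _) hv).

Lemma vl2_lin : lin (vl2 : Vl2 -> V[K, H]).
Proof. by move=> a x y. Qed.

Lemma Vl2_inj (x y : Vl2) : vl2 x = vl2 y -> x = y.
Proof. exact: val_inj. Qed.

Variables (ipH : H -> H -> R[i]) (ipK : K -> K -> R[i]).
Hypotheses (hipH : inner_product ipH) (hipK : inner_product ipK).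

Definition re_ipV (v w : V[K, H]) : R := re_ip ipK v.1 w.1 + re_ip2 ipH v.2 w.2.

Lemma re_ipV_normV v : inV v -> re_ipV v v = normV v ^+ 2.
Proof.
move=> hv; rewrite normV_sqr// /re_ipV (re_ip_nrm hipK).
by rewrite (re_ip2_norm2 hipH hv).
Qed.

Variable F : V[K, H] -> V[K, H].
Hypotheses (FV : forall v, inV v -> inV (F v))
  (FL : forall a v w, inV v -> inV w -> F (a *: v + w) = a *: F v + F w).

(** For [F] the inverse of a similarity, this is the equivalent Hilbert structure in which the given
    operator becomes a contraction. *)
Lemma pullback_semi_inner : semi_inner (fun u v : Vl2 => re_ipV (F (vl2 u)) (F (vl2 v))).
Proof.
have rS := re_ip_semi_inner hipK.
have F2 (u : Vl2) : l2 (F (vl2 u)).2 by apply: FV; exact: Vl2P.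
have FD (u v : Vl2) : F (vl2 u + vl2 v) = F (vl2 u) + F (vl2 v).
  by rewrite -{1}(scale1r (vl2 u)) FL ?scale1r//; exact: Vl2P.
have F0 : F 0 = 0.
  by apply: (addrI (F 0)); rewrite -{1}(scale1r (F 0)) -FL;
    [rewrite scale1r !addr0|exact: l2_0|exact: l2_0].
have FZ a (u : Vl2) : F (a *: vl2 u) = a *: F (vl2 u).
  by rewrite -{1}(addr0 (a *: vl2 u)) FL ?F0 ?addr0//; [exact: Vl2P|exact: l2_0].
split=> [x y z|x y|t x y|a x y|x]; rewrite /re_ipV.
- have -> : vl2 (x + y) = vl2 x + vl2 y by [].
  by rewrite FD (semi_innerDl rS) (re_ip2Dl hipH)// addrACA.
- by rewrite (semi_innerC rS) (re_ip2C hipH).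
- have -> : vl2 (t%:C *: x) = t%:C *: vl2 x by [].
  by rewrite FZ (semi_innerZr rS) (re_ip2Z hipH)// mulrDr.
- have -> : vl2 (a *: x) = a *: vl2 x by [].
  have -> : vl2 (a^* *: y) = a^* *: vl2 y by [].
  by rewrite !FZ (semi_innerJ rS) (re_ip2J hipH).
- by rewrite -/(re_ipV _ _) re_ipV_normV ?sqr_ge0//; exact: F2.
Qed.

End Subtype.

Lemma l2_dominated (R : realType) (H : completeNormedModType R[i])
    (x y : nat -> H) (c : R) : 0 <= c -> l2 x ->
  (forall N, psum2 y N <= c ^+ 2 * norm2 x) ->
  l2 y /\ Num.sqrt (norm2 y) <= c * Num.sqrt (norm2 x).
Proof.
move=> c0 lx h; have ly : l2 y by apply/l2P; exists (c ^+ 2 * norm2 x).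
split=> //; rewrite -{1}(ger0_norm c0) -sqrtr_sqr -sqrtrM ?sqr_ge0// ler_wsqrtr//.
exact: norm2_le.
Qed.

(** * Operators on square-summable sequences *)

Section Operators.
Variables (R : realType) (H K : completeNormedModType R[i]).

Lemma opl2_post (G : K -> K) (Y : (nat -> H) -> K) : lin G ->
  (forall k, nrm (G k) <= nrm k) -> bounded_op_l2K Y ->
  bounded_op_l2K (fun x => G (Y x)).
Proof.
move=> GL Gc hY; have [c c0 Yc] := opl2_bound hY.
apply: (@mk_opl2 _ _ _ _ c) => [a x y lx ly|x lx].
  by case: hY => h _; rewrite h// GL.
by rewrite (le_trans (Gc _))// Yc.
Qed.

Lemma opl2_comp (G : (nat -> H) -> (nat -> H)) (b : R) (Y : (nat -> H) -> K) :
  lin G -> 0 <= b ->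
  (forall x, l2 x -> l2 (G x) /\ Num.sqrt (norm2 (G x)) <= b * Num.sqrt (norm2 x)) ->
  bounded_op_l2K Y -> bounded_op_l2K (fun x => Y (G x)).
Proof.
move=> GL b0 Gb hY; have [c c0 Yc] := opl2_bound hY.
apply: (@mk_opl2 _ _ _ _ (c * b)) => [a x y lx ly|x lx].
  by case: hY => h _; rewrite GL h//; [exact: (Gb _ lx).1|exact: (Gb _ ly).1].
have [lGx Gx] := Gb _ lx.
by rewrite (le_trans (Yc _ _))// -mulrA ler_wpM2l.
Qed.

Lemma opl2_sub (Y Y' : (nat -> H) -> K) : bounded_op_l2K Y -> bounded_op_l2K Y' ->
  bounded_op_l2K (fun x => Y x - Y' x).
Proof.
move=> hY hY'; have [c c0 Yc] := opl2_bound hY; have [c' c0' Yc'] := opl2_bound hY'.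
apply: (@mk_opl2 _ _ _ _ (c + c')) => [a x y lx ly|x lx].
  by case: hY => h _; case: hY' => h' _; rewrite h// h'// scalerBr opprD addrACA.
by rewrite (le_trans (ler_nrmD _ _))// nrmN mulrDl lerD// ?Yc ?Yc'.
Qed.

Lemma opl2_add (Y Y' : (nat -> H) -> K) : bounded_op_l2K Y -> bounded_op_l2K Y' ->
  bounded_op_l2K (fun x => Y x + Y' x).
Proof.
move=> hY hY'; have [c c0 Yc] := opl2_bound hY; have [c' c0' Yc'] := opl2_bound hY'.
apply: (@mk_opl2 _ _ _ _ (c + c')) => [a x y lx ly|x lx].
  by case: hY => h _; case: hY' => h' _; rewrite h// h'// scalerDr addrACA.
by rewrite (le_trans (ler_nrmD _ _))// mulrDl lerD// ?Yc ?Yc'.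
Qed.

Lemma head_le (x : nat -> H) : l2 x -> nrm (x 0%N) <= Num.sqrt (norm2 x).
Proof.
move=> lx; rewrite -[nrm _]ger0_norm ?nrm_ge0// -sqrtr_sqr ler_wsqrtr//.
by rewrite (le_trans _ (psum2_le 1 lx))// /psum2 big_ord1.
Qed.

Lemma opl2_head (Y : (nat -> H) -> K) : bounded_op_l2K Y ->
  bounded_op_l2K (fun x => Y (single (x 0%N) 0)).
Proof.
apply: (@opl2_comp (fun x => single (x 0%N) 0) 1) => // [a x y|x lx].
  exact: singleZD.
split; first exact: l2_single.
by rewrite mul1r norm2_single sqrtr_sqr ger0_norm ?nrm_ge0// head_le.
Qed.

Definition diag (d : nat -> R[i]) (x : nat -> H) : nat -> H := fun n => d n *: x n.

Lemma diag_lin d : lin (diag d).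
Proof.
move=> a x y; apply/funext => n.
by rewrite /diag -[RHS]/(a *: (d n *: x n) + d n *: y n) scalerDr !scalerA mulrC.
Qed.

Lemma diag_l2 d (b : R) x : 0 <= b -> (forall n, nrm (d n) <= b) -> l2 x ->
  l2 (diag d x) /\ Num.sqrt (norm2 (diag d x)) <= b * Num.sqrt (norm2 x).
Proof.
move=> b0 db lx; apply: l2_dominated => // N.
apply: le_trans (_ : b ^+ 2 * psum2 x N <= _); last by rewrite ler_wpM2l ?sqr_ge0// psum2_le.
rewrite /psum2 mulr_sumr; apply: ler_sum => n _; rewrite nrmZ exprMn ler_wpM2r ?sqr_ge0//.
by rewrite ler_sqr ?nnegrE ?nrm_ge0.
Qed.

End Operators.

(** * The weighted shift, the powers of R(A), and nearness from an intertwiner *)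

Section Shift.
Variables (R : realType) (H K : completeNormedModType R[i]).
Variables (w : nat -> R[i]) (w_pos : forall k, 0 < w k).
Variables (b : R) (b0 : 0 <= b) (wb : forall k, nrm (w k) <= b).

Lemma shift_lin : lin (wshift w : (nat -> H) -> _).
Proof.
move=> a x y; apply/funext => -[|n] /=.
  by rewrite -[RHS]/(a *: 0 + 0) scaler0 addr0.
by rewrite -[RHS]/(a *: (w n *: x n) + w n *: y n) scalerDr !scalerA mulrC.
Qed.

Lemma shift_psum2 (x : nat -> H) N : psum2 (wshift w x) N.+1 = psum2 (diag w x) N.
Proof. by rewrite /psum2 big_ord_recl /= nrm0 expr0n add0r; apply: eq_bigr. Qed.

Lemma shift_l2 (x : nat -> H) : l2 x ->
  l2 (wshift w x) /\ Num.sqrt (norm2 (wshift w x)) <= b * Num.sqrt (norm2 x).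
Proof.
move=> lx; apply: l2_dominated => // N.
have [lD nD] := diag_l2 b0 wb lx.
apply: le_trans (_ : psum2 (wshift w x) N.+1 <= _); first exact: psum2_nd.
rewrite shift_psum2 (le_trans (psum2_le _ lD))// -(sqr_sqrtr (norm2_ge0 lD)).
rewrite -(sqr_sqrtr (norm2_ge0 lx)) -exprMn ler_sqr// nnegrE ?sqrtr_ge0//.
by rewrite mulr_ge0// sqrtr_ge0.
Qed.

Lemma shift_single (h : H) n : wshift w (single h n) = single (w n *: h) n.+1.
Proof.
apply/funext => -[|m] //=; rewrite /single eqSS.
by case: eqP => [->|]; rewrite ?scaler0.
Qed.

Lemma betaS n : beta w n.+1 = beta w n * w n.
Proof. by rewrite /beta big_ord_recr. Qed.

Lemma beta_neq0 n : beta w n != 0.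
Proof. by rewrite /beta; apply/prodf_neq0 => k _; rewrite gt_eqF. Qed.

Variables (T : K -> K) (TL : lin T) (Tc : forall k, nrm (T k) <= nrm k).

(** R(A)^n and R(0)^n agree on [h e_0] in the sequence component, and R(0)^n has no component in [K]
    there; so this is all that quadratic nearness measures. *)
Definition delta (A : (nat -> H) -> K) n h : K :=
  (iter n (Rop T w A) (0, single h 0)).1.

Lemma iter_Rop A n h :
  iter n (Rop T w A) (0, single h 0) = (delta A n h, single (beta w n *: h) n).
Proof.
rewrite /delta; set v := iter _ _ _; suff <- : v.2 = single (beta w n *: h) n by case: v.
rewrite /v; elim: n {v} => [|n IH] /=; first by rewrite /beta big_ord0 scale1r.
by rewrite IH shift_single scalerA betaS mulrC.
Qed.

Lemma deltaS A n h : delta A n.+1 h = T (delta A n h) + A (single (beta w n *: h) n).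
Proof. by rewrite /delta iterS iter_Rop. Qed.

Lemma delta0 n h : delta (fun=> 0) n h = 0.
Proof. by elim: n => [//|n IH]; rewrite deltaS IH (lin0 TL) addr0. Qed.

Lemma delta_lin A n : bounded_op_l2K A -> lin (delta A n).
Proof.
move=> hA a h k; elim: n => [|n IH].
  by rewrite /delta /= scaler0 addr0.
rewrite !deltaS IH TL scalerDr scalerA mulrC -scalerA singleZD.
case: (hA) => -> //; try exact: l2_single.
by rewrite scalerDr addrACA.
Qed.

Lemma first_sum A N (h : nat -> H) :
  \sum_(n < N) (beta w n)^-1 *: (iter n (Rop T w A) (0, single (h n) 0)
     - iter n (Rop T w (fun=> 0)) (0, single (h n) 0))
  = (\sum_(n < N) (beta w n)^-1 *: delta A n (h n), 0).
Proof.
rewrite (eq_bigr (fun n : 'I_N => ((beta w n)^-1 *: delta A n (h n), 0) : V[K, H])).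
  elim: N => [|N IH]; first by rewrite !big_ord0.
  rewrite !big_ord_recr /= IH.
  by congr pair; rewrite /= addr0.
move=> n _; rewrite !iter_Rop delta0.
by congr pair; rewrite /= ?subr0// subrr scaler0.
Qed.

(** By induction, started by the vanishing of [Z] on [h e_0], [delta A n h] equals [Z] at
    [beta(n) h e_n]. The weighted sum is then [Z] of a truncated sequence, and any bound of [Z]
    serves as [s]. *)
Lemma intertwined_near (A Z : (nat -> H) -> K) : bounded_op_l2K Z ->
  (forall h, Z (single h 0) = 0) ->
  (forall x, l2 x -> A x = Z (wshift w x) - T (Z x)) ->
  beta_quad_near w (Rop T w A) (Rop T w (fun=> 0)).
Proof.
move=> hZ Z0 AZ; have [c c0 Zc] := opl2_bound hZ.
have dE n h : delta A n h = Z (single (beta w n *: h) n).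
  elim: n => [|n IH]; first by rewrite Z0.
  rewrite deltaS IH AZ; last exact: l2_single.
  by rewrite addrC subrK shift_single scalerA betaS mulrC.
exists c%:C => N x hx; pose h n := (x n).2 0%N.
have xE n : x n = (0, single (h n) 0).
  by have [x1 /single_head x2] := hx n; rewrite /h; case: (x n) x1 x2 => u v /= -> {1}->.
rewrite (eq_bigr (fun n : 'I_N.+1 => (beta w n)^-1 *: (iter n (Rop T w A) (0, single (h n) 0)
     - iter n (Rop T w (fun=> 0)) (0, single (h n) 0)))); last by move=> n _; rewrite xE.
rewrite first_sum.
have -> : \sum_(n < N.+1) (beta w n)^-1 *: delta A n (h n) = Z (trunc N.+1 h).
  rewrite opl2_trunc//; apply: eq_bigr => n _; rewrite dE -opl2Z//; last exact: l2_single.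
  congr Z; apply/funext => m; rewrite -[LHS]/(_ *: single _ _ m) /single.
  by case: ifP; rewrite ?scaler0// scalerA mulVf ?scale1r// beta_neq0.
have -> : \sum_(n < N.+1) vnorm (x n) ^+ 2 = (psum2 h N.+1)%:C.
  rewrite /psum2 rmorph_sum; apply: eq_bigr => n _.
  have iVx : inV (x n) by rewrite xE; exact: l2_single.
  rewrite vnormE// -rmorphXn normV_sqr// xE /= nrm0 expr0n add0r norm2_single.
  by [].
rewrite sqrtC_real ?psum2_ge0// vnormE; last exact: l2_0.
rewrite -rmorphM lecR; apply: (le_trans (normV_le _)); first exact: l2_0.
rewrite /= norm2_0 sqrtr0 addr0 (le_trans (Zc _ _))//; first exact: l2_trunc.
by rewrite ler_wpM2l// ler_wsqrtr// norm2_trunc.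
Qed.

End Shift.

(** The adjoint is given as a mere function; its linearity follows by pairing with every [z] and
    moving to [T]. *)
Lemma coisometry_adjoint (R : realType) (K : completeNormedModType R[i])
    (ip : K -> K -> R[i]) (hip : inner_product ip) (T : K -> K) :
  lin T -> coisometry ip T -> exists V : K -> K, [/\ lin V, forall k, T (V k) = k &
    forall x y, re_ip ip (T x) y = re_ip ip x (V y)].
Proof.
move=> TL [V [adj TV]]; exists V; split=> //; last by move=> x y; rewrite /re_ip adj.
have rS := re_ip_semi_inner hip.
have adjr x y : re_ip ip (V y) x = re_ip ip y (T x).
  by rewrite (semi_innerC rS) /re_ip -adj -/(re_ip ip _ _) (semi_innerC rS).
move=> a x y; apply: (re_ip_inj hip) => z.
by rewrite (semi_innerDl rS) adjr (semi_innerDl rS) !(semi_innerJ rS) !adjr (linZ TL).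
Qed.

(** * From similarity to quadratic nearness *)

Section Main.
Variables (R : realType) (H K : completeNormedModType R[i])
  (ipH : H -> H -> R[i]) (ipK : K -> K -> R[i]).
Hypotheses (hipH : inner_product ipH) (hipK : inner_product ipK).
Variables (w : nat -> R[i]) (w_pos : forall k, 0 < w k).
Variables (b : R) (b0 : 0 <= b) (wb : forall k, nrm (w k) <= b).
Variables (T V : K -> K) (TL : lin T) (VL : lin V) (TV : forall k, T (V k) = k)
  (adjTV : forall x y, re_ip ipK (T x) y = re_ip ipK x (V y)).
Variables (X : (nat -> H) -> K) (hX : bounded_op_l2K X).

Lemma nrm_T k : nrm (T k) <= nrm k.
Proof.
rewrite -ler_sqr ?nnegrE ?nrm_ge0// -(pythagoras_coisometry hipK TV adjTV k).
by rewrite lerDr sqr_ge0.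
Qed.

Lemma Rop_inV (Y : (nat -> H) -> K) v : inV v -> inV (Rop T w Y v).
Proof. by move=> hv; exact: (shift_l2 b0 wb hv).1. Qed.

Lemma Rop_lin (Y : (nat -> H) -> K) : bounded_op_l2K Y ->
  forall a v v', inV v -> inV v' ->
  Rop T w Y (a *: v + v') = a *: Rop T w Y v + Rop T w Y v'.
Proof.
move=> [YL _] a v v' hv hv'; rewrite /Rop /= shift_lin TL YL//.
by congr pair; rewrite /= scalerDr addrACA.
Qed.

(** The powers are [L C^n Li] with [C] a contraction, so the product of the bounds of [L] and [Li]
    works for all [n]. *)
Lemma similar_power_bounded : similar_to_contraction (Rop T w X) ->
  power_bounded (Rop T w X).
Proof.
move=> [L [Li [hL hLi LK Lc]]].
have [c c0 Lb] := opV_bound hL; have [c' c0' Lib] := opV_bound hLi.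
have [LV _ _] := hL; have [LiV _ _] := hLi.
have iV n v : inV v -> inV (iter n (Rop T w X) v).
  by move=> hv; elim: n => //= n; exact: Rop_inV.
have h n v : inV v -> normV (Li (iter n (Rop T w X) v)) <= normV (Li v).
  move=> hv; elim: n => // n IH; apply: le_trans IH; set u := iter n _ v.
  have iu : inV u := iV n _ hv.
  have := Lc _ (LiV _ iu); rewrite (LK _ iu).2 !vnormE ?lecR//; first exact: LiV.
  exact/LiV/Rop_inV.
exists (c * c')%:C => n v hv; have iu := iV n v hv.
rewrite !vnormE// -rmorphM lecR -[X in normV X](LK _ iu).2.
rewrite (le_trans (Lb _ (LiV _ iu)))// -mulrA ler_wpM2l//.
by rewrite (le_trans (h _ _ hv))// Lib.
Qed.

(** The extension [P] of the coordinate in [K] satisfies [T P = P R(X)]. At [(0, x)] this reads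
    [T P (0, x) = X x + P (0, S_w x)], which is the claim for [Z x = - P (0, x)]. *)
Lemma similar_intertwiner : similar_to_contraction (Rop T w X) ->
  exists2 Z : (nat -> H) -> K, bounded_op_l2K Z &
    forall x, l2 x -> X x = Z (wshift w x) - T (Z x).
Proof.
move=> [L [Li [hL hLi LK Lc]]].
have [c c0 Lb] := opV_bound hL; have [c' c0' Lib] := opV_bound hLi.
have [LV _ _] := hL; have [LiV LiL _] := hLi.
pose B (u v : Vl2 H K) := re_ipV ipH ipK (Li (vl2 u)) (Li (vl2 v)).
have hB : semi_inner B by exact: pullback_semi_inner.
have snE u : Num.sqrt (B u u) = normV (Li (vl2 u)).
  by rewrite /B re_ipV_normV ?sqrtr_sqr ?ger0_norm ?normV_ge0//; exact/LiV/Vl2P.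
pose W (u : Vl2 H K) := toVl2 (Rop_inV X (Vl2P u)).
have WL : lin W.
  by move=> a u v; apply: Vl2_inj => /=; rewrite Rop_lin//; exact: Vl2P.
have WB u : B (W u) (W u) <= B u u.
  rewrite -(sn_sqr hB) -[leRHS](sn_sqr hB) ler_sqr ?nnegrE ?sqrtr_ge0// !snE /=.
  have iu := Vl2P u; have := Lc _ (LiV _ iu); rewrite (LK _ iu).2.
  rewrite !vnormE ?lecR//; first exact: LiV.
  exact/LiV/Rop_inV.
pose S (u : Vl2 H K) := (vl2 u).2 = 0.
have SD u v : S u -> S v -> S (u + v).
  by rewrite /S => u0 v0; rewrite -[LHS]/((vl2 u).2 + (vl2 v).2) u0 v0 addr0.
have SZ a u : S u -> S (a *: u).
  by rewrite /S => u0; rewrite -[LHS]/(a *: (vl2 u).2) u0 scaler0.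
have S0 : exists u, S u by exists 0.
have shift0 : wshift w (0 : nat -> H) = 0 by exact: lin0 (@shift_lin _ _ w).
have SW u : S u -> S (W u) by rewrite /S /= => ->.
pose J (u : Vl2 H K) : K := (vl2 u).1.
have JL : lin J by [].
(* The constant is the bound of [L], since [u = L (Li u)] and [sn u] is the norm of [Li u]. *)
have Jc u : S u -> nrm (J u) <= c * Num.sqrt (B u u).
  move=> _; rewrite snE (le_trans (nrm_le_normV (Vl2P u)))//.
  by rewrite -{1}(LK _ (Vl2P u)).2; apply: Lb; exact/LiV/Vl2P.
have JW u : S u -> T (J u) = J (W u).
  by rewrite /S /J /= => ->; rewrite (opl2_0 hX) addr0.
have [P [PL PJ Pc] PW] := intertwining_extension hB WL WB SD SZ S0 SW hipK
  TL VL TV adjTV c0 JL Jc JW.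
have in0 x : l2 x -> inV ((0, x) : V[K, H]) by [].
(* [P] acts on square-summable pairs only; elsewhere [Z] takes the default value [0]. *)
pose Z x := if pselect (l2 x) is left lx then - P (toVl2 (in0 x lx)) else 0.
have ZE x (u : Vl2 H K) : vl2 u = (0, x) -> Z x = - P u.
  move=> uE; rewrite /Z; case: pselect => [lx|].
    by congr (- P _); apply: Vl2_inj.
  by have := Vl2P u; rewrite uE.
exists Z.
  apply: (@mk_opl2 _ _ _ _ (c * c')) => [a x y lx ly|x lx].
    rewrite (ZE x (toVl2 (in0 x lx)))// (ZE y (toVl2 (in0 y ly)))//.
    rewrite (ZE (a *: x + y) (a *: toVl2 (in0 x lx) + toVl2 (in0 y ly))).
      by rewrite PL opprD scalerN.
    by rewrite vl2_lin /=; congr pair; rewrite /= scaler0 addr0.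
  rewrite (ZE x (toVl2 (in0 x lx)))// nrmN (le_trans (Pc _))// snE /= -mulrA ler_wpM2l//.
  rewrite (le_trans (Lib _ _))// ler_wpM2l// (le_trans (normV_le _))//=.
  by rewrite nrm0 add0r.
move=> x lx; have lS := (shift_l2 b0 wb lx).1.
pose k : V[K, H] := (X x, 0); have ik : inV k by exact: l2_0.
pose u := toVl2 (in0 x lx).
have := PW u.
have -> : W u = toVl2 ik + toVl2 (in0 _ lS).
  apply: Vl2_inj; rewrite (linD (@vl2_lin _ _ _)) /= /Rop /= (lin0 TL).
  by congr pair; rewrite /= ?add0r ?addr0.
rewrite (linD PL) (PJ (toVl2 ik) erefl) /J /= => h.
by rewrite (ZE _ (toVl2 (in0 _ lS)))// (ZE x u)// (linN TL) h opprK addrC addrK.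
Qed.

(** Nearness asks for an intertwiner vanishing on [h e_0], so [Z P_0] is removed from [Z], with
    [P_0] the projection onto the first coordinate. As [P_0 S_w = 0], this changes [X] only by
    [Y = T Z P_0]. The correction [E] reads only the first coordinate, which is [0] on the ranges of
    R(A) and of [E]. *)
Lemma similar_decomposition : similar_to_contraction (Rop T w X) ->
   exists (A : (nat -> H) -> K) (E : V[K, H] -> V[K, H]),
     [/\ bounded_op_l2K A, bounded_op_V E,
         (forall v, inV v -> E (E v) = 0) /\
           (forall v, inV v -> E (Rop T w A v) = 0),
         forall v, inV v -> Rop T w X v = Rop T w A v + E v
       & beta_quad_near w (Rop T w A) (Rop T w (fun _ => 0))].
Proof.
move=> /similar_intertwiner[Z hZ XZ].
pose Y x := T (Z (single (x 0%N) 0)).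
have hY : bounded_op_l2K Y by apply: (opl2_post TL nrm_T); exact: opl2_head.
have Y0 (x : nat -> H) : x 0%N = 0 -> Y x = 0.
  by move=> x0; rewrite /Y x0 single0 (opl2_0 hZ) (lin0 TL).
pose Z' x := Z x - Z (single (x 0%N) 0).
have hZ' : bounded_op_l2K Z' by apply: opl2_sub => //; exact: opl2_head.
have [c c0 Yc] := opl2_bound hY.
exists (fun x => X x + Y x), (fun v => (- Y v.2, 0)); split.
- exact: opl2_add.
- apply: (@mk_opV _ _ _ _ c) => [v hv|a v v' hv hv'|v hv].
  + exact: l2_0.
  + congr pair; rewrite /= ?scaler0 ?addr0//.
    by case: hY => h _; rewrite h// opprD scalerN.
  + rewrite (le_trans (normV_le _))//=; first exact: l2_0.
    rewrite norm2_0 sqrtr0 addr0 nrmN (le_trans (Yc _ hv))// ler_wpM2l//.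
    exact: norm2_le_normV.
- split=> v hv; congr pair; rewrite /= Y0 ?oppr0//.
- move=> v hv; congr pair; rewrite /= ?addr0//.
  by rewrite addrA addrK.
- apply: (intertwined_near w_pos TL hZ') => [h|x lx]; rewrite /Z'.
    by rewrite (_ : single (single h 0 0%N) 0 = single h 0) ?subrr.
  rewrite /= (linB TL) XZ// -/(Y x) opprB addrA.
  by rewrite single0 (opl2_0 hZ) subr0 addrAC.
Qed.

End Main.

(** * From quadratic nearness to similarity *)

(** [Z x] is the sum of the [z n (x n)]. The hypothesis applied to the tails [x - trunc N x] makes
    the partial sums Cauchy, and applied to [x] it bounds the limit. *)
Lemma coefficient_operator (R : realType) (H K : completeNormedModType R[i])
    (z : nat -> H -> K) (s : R) : 0 <= s -> (forall n, lin (z n)) ->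
  (forall N (h : nat -> H), nrm (\sum_(n < N) z n (h n)) <= s * Num.sqrt (psum2 h N)) ->
  exists2 Z : (nat -> H) -> K, bounded_op_l2K Z &
    forall h n, Z (single h n) = z n h.
Proof.
move=> s0 zL zs; pose u (x : nat -> H) N := \sum_(n < N) z n (x n).
have tail x N M : (N <= M)%N -> u x M - u x N = u (x - trunc N x) M.
  move=> NM; rewrite /u -(subnKC NM) !big_split_ord /= addrAC subrr add0r.
  rewrite [X in _ = X + _]big1 ?add0r => [|i _]; last first.
    by rewrite -[(x - _) _]/(x _ - trunc N x _) /trunc ltn_ord subrr (lin0 (zL _)).
  apply: eq_bigr => i _.
  by rewrite -[(x - _) _]/(x _ - trunc N x _) /trunc ltnNge leq_addr subr0.
have ex x : exists g : K, l2 x -> u x @ \oo --> g.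
  have [lx|nlx] := pselect (l2 x); last by exists 0.
  have [e e0|g Hg] := @nrm_cauchy _ _ (u x); last first.
    by exists g => _; exact/nrm_cvgP.
  have [|N0 H0] := @tail_small _ _ x (e / (s + 1)) lx.
    by rewrite divr_gt0// ltr_wpDl.
  have key n m : (N0 <= n)%N -> (n <= m)%N -> nrm (u x m - u x n) <= e.
    move=> Nn nm; rewrite (tail _ _ _ nm) (le_trans (zs _ _))//.
    apply: le_trans (scaled_frac_le s0 e0); rewrite ler_wpM2l//.
    apply: le_trans (H0 _ Nn); rewrite ler_wsqrtr// psum2_le//.
    by apply: l2B => //; exact: l2_trunc.
  exists N0 => n m Nn Nm; case: (leqP n m) => nm; last exact: key (ltnW nm).
  by rewrite nrm_distC; exact: key.
have [Z HZ] := choice ex; exists Z.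
  apply: (@mk_opl2 _ _ _ _ s) => [a x y lx ly|x lx].
    have lxy : l2 (a *: x + y) by apply: l2D => //; exact: l2Z.
    apply: (lim_uniq (HZ _ lxy)).
    rewrite (_ : u (a *: x + y) = (fun N => a *: u x N + u y N)).
      by apply: cvgD; [apply: cvgZl_tmp|]; exact: HZ.
    apply/funext => N; rewrite /u scaler_sumr -big_split /=.
    by apply: eq_bigr => n _; exact: zL.
  apply: nrm_lim_le (HZ _ lx) _ => N.
  by rewrite (le_trans (zs _ _))// ler_wpM2l// ler_wsqrtr// psum2_le.
move=> h n; apply: (lim_uniq (HZ _ (l2_single h n))).
apply/nrm_cvgP => e e0; exists n.+1 => N nN.
rewrite /u (bigD1 (Ordinal nN)) //= /single eqxx big1 ?addr0 ?subrr ?nrm0 ?ltW// => i.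
by rewrite -val_eqE /= => /negPf ->; exact: lin0.
Qed.

Section Converse.
Variables (R : realType) (H K : completeNormedModType R[i])
  (ipH : H -> H -> R[i]) (ipK : K -> K -> R[i]).
Hypotheses (hipH : inner_product ipH) (hipK : inner_product ipK).
Variables (w : nat -> R[i]) (w_pos : forall k, 0 < w k).
Variables (b : R) (b0 : 0 <= b) (wb : forall k, nrm (w k) <= b).
Variables (T V : K -> K) (TL : lin T) (VL : lin V) (TV : forall k, T (V k) = k)
  (adjTV : forall x y, re_ip ipK (T x) y = re_ip ipK x (V y)).
Variables (X : (nat -> H) -> K) (hX : bounded_op_l2K X).

Lemma iter_shift m n (h : H) : (iter m (Rop T w X) (0, single h n)).2 =
  single ((\prod_(i < m) w (n + i)%N) *: h) (n + m).
Proof.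
elim: m => [|m IH] /=; first by rewrite big_ord0 scale1r addn0.
by rewrite IH shift_single scalerA big_ord_recr /= mulrC addnS.
Qed.

(* [d n = sup_m w_n ... w_(n+m-1)]; when [H = 0] this supremum may be infinite,
   and [d = 1] does. *)
Lemma renorming_weights : power_bounded (Rop T w X) ->
  exists (d : nat -> R) (M : R), (forall n, 1 <= d n <= M) /\
    forall n (h : H), d n.+1 * nrm (w n *: h) <= d n * nrm h.
Proof.
move=> [M HM].
have [[h h0]|nH] := pselect (exists h : H, h <> 0); last first.
  exists (fun=> 1), 1; split=> [n|n h]; first by rewrite lexx.
  suff -> : h = 0 by rewrite scaler0.
  by apply: contrapT => h0; apply: nH; exists h.
have nh0 : 0 < nrm h.
  rewrite lt_neqAle nrm_ge0 andbT; apply/eqP => /esym h1.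
  by apply/h0/nrm_le0; rewrite h1.
pose p n m : R := \prod_(i < m) nrm (w (n + i)%N).
have pE n m : nrm (\prod_(i < m) w (n + i)%N) = p n m.
  apply: complexI; rewrite -nrmE normr_prod rmorph_prod.
  by apply: eq_bigr => i _; rewrite nrmE.
(* Power boundedness is tested at [h e_n] for the fixed nonzero [h]: the sequence component after
   [m] steps has norm [p n m * nrm h]. *)
have pM n m : p n m <= nrm M.
  rewrite -(ler_pM2r nh0) -pE -nrmZ.
  have iv : inV ((0, single h n) : V[K, H]) by exact: l2_single.
  have iu : inV (iter m (Rop T w X) (0, single h n)).
    by elim: m => //= m; exact: (Rop_inV b0 wb T X).
  have := HM m _ iv; rewrite !vnormE// => /(real_bound (normV_ge0 _) (normV_ge0 _)).
  rewrite {2}/normV /= nrm0 expr0n add0r norm2_single sqrtr_sqr ger0_norm ?nrm_ge0//.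
  apply: le_trans; apply: le_trans (norm2_le_normV iu).
  by rewrite iter_shift norm2_single sqrtr_sqr ger0_norm ?nrm_ge0.
pose A n := [set p n m | m in [set: nat]].
have ubA n : ubound (A n) (nrm M) by move=> _ [m _ <-].
have supA n : has_sup (A n) by split; [exists (p n 0), 0|exists (nrm M)].
have ple n m : p n m <= sup (A n) by apply: sup_upper_bound => //; exists m.
(* The empty product [p n 0 = 1] gives the lower bound. *)
exists (fun n => sup (A n)), (nrm M); split=> [n|n k].
  apply/andP; split; first by rewrite (le_trans _ (ple n 0))// /p big_ord0.
  by apply: ge_sup => //; exact: (supA n).1.
rewrite nrmZ mulrA ler_wpM2r ?nrm_ge0//.
have wn0 : 0 < nrm (w n) by rewrite -ltcR -nrmE gtr0_norm.
rewrite -ler_pdivlMr//; apply: ge_sup => [|_ [m _ <-]]; first exact: (supA _).1.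
(* [w n] times the product [p n.+1 m] is [p n m.+1], one of the products under the supremum
   [d n]. *)
rewrite ler_pdivlMr//; apply: le_trans (ple n m.+1).
rewrite /p big_ord_recl /= addn0 mulrC ler_wpM2l ?nrm_ge0//.
by apply: ler_prod => i _; rewrite nrm_ge0 /= addSnnS.
Qed.

(** The similarity combines the triangular change [(k, x) -> (k + Z x, x)], which removes [X], with
    the diagonal rescaling [D']. It turns R(X) into [T] on [K] and [D S_w D'] on sequences; the
    latter is a contraction by the choice of [d]. *)
Lemma intertwined_similar (Z : (nat -> H) -> K) : bounded_op_l2K Z ->
  (forall x, l2 x -> X x = Z (wshift w x) - T (Z x)) ->
  power_bounded (Rop T w X) -> similar_to_contraction (Rop T w X).
Proof.
move=> hZ XZ /renorming_weights[d [M [d1M dw]]].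
have d0 n : 0 < d n by have /andP[h _] := d1M n; rewrite (lt_le_trans ltr01).
have M0 : 0 <= M by have /andP[h h'] := d1M 0; rewrite (le_trans _ (le_trans h h')).
pose D : (nat -> H) -> (nat -> H) := diag (fun n => (d n)%:C).
pose D' : (nat -> H) -> (nat -> H) := diag (fun n => ((d n)^-1)%:C).
have DL : lin D by exact: diag_lin.
have DL' : lin D' by exact: diag_lin.
have Db x : l2 x -> l2 (D x) /\ Num.sqrt (norm2 (D x)) <= M * Num.sqrt (norm2 x).
  apply: diag_l2 => // n; rewrite nrm_real gtr0_norm//.
  by have /andP[] := d1M n.
have Db' x : l2 x -> l2 (D' x) /\ Num.sqrt (norm2 (D' x)) <= 1 * Num.sqrt (norm2 x).
  apply: diag_l2 => // n; rewrite nrm_real gtr0_norm ?invr_gt0//.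
  by rewrite invf_le1//; have /andP[] := d1M n.
have dd n : (d n)%:C * ((d n)^-1)%:C = 1 :> R[i].
  by rewrite -rmorphM mulfV ?gt_eqF.
have DK x : D (D' x) = x.
  by apply/funext => n; rewrite /D /D' /diag scalerA dd scale1r.
have DK' x : D' (D x) = x.
  by apply/funext => n; rewrite /D /D' /diag scalerA mulrC dd scale1r.
have [c c0 Zc] := opl2_bound hZ; have [ZL _] := hZ.
exists (fun v => (v.1 + Z (D' v.2), D' v.2)), (fun v => (v.1 - Z v.2, D v.2)); split.
- apply: (@mk_opV _ _ _ _ (1 + c + 1)) => [v hv|a v v' hv hv'|v hv].
  + exact: (Db' _ hv).1.
  + congr pair; rewrite /= DL'// ZL; [|exact: (Db' _ hv).1|exact: (Db' _ hv').1].
    by rewrite scalerDr addrACA.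
  + have [lD nD] := Db' _ hv; rewrite (le_trans (normV_le _))//=.
    have h1 := nrm_le_normV hv; have h2 := norm2_le_normV hv.
    rewrite mul1r in nD; have h3 := le_trans nD h2.
    rewrite !mulrDl !mul1r lerD// (le_trans (ler_nrmD _ _))// lerD//.
    by rewrite (le_trans (Zc _ _))// ler_wpM2l.
- apply: (@mk_opV _ _ _ _ (1 + c + M)) => [v hv|a v v' hv hv'|v hv].
  + exact: (Db _ hv).1.
  + by congr pair; rewrite /= ?DL// ZL// scalerBr opprD addrACA.
  + have [lD nD] := Db _ hv; rewrite (le_trans (normV_le _))//=.
    have h1 := nrm_le_normV hv; have h2 := norm2_le_normV hv.
    rewrite !mulrDl !mul1r lerD// ?(le_trans nD) ?ler_wpM2l//.
    rewrite (le_trans (ler_nrmD _ _))// lerD// nrmN.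
    by rewrite (le_trans (Zc _ _))// ler_wpM2l.
- move=> v hv; split.
    by case: v hv => k x hv /=; rewrite addrK DK.
  by case: v hv => k x hv /=; rewrite DK' subrK.
- move=> v hv; have [lD nD] := Db' _ hv; have lS := (shift_l2 b0 wb lD).1.
  have [lDS _] := Db _ lS.
  rewrite /Rop /= (linD TL) XZ//.
  have -> : T v.1 + T (Z (D' v.2)) + (Z (wshift w (D' v.2)) - T (Z (D' v.2))) -
     Z (wshift w (D' v.2)) = T v.1.
    by rewrite [X in _ + X - _]addrC addrA addrK addrK.
  rewrite !vnormE// lecR ler_wsqrtr//= lerD//.
    by rewrite ler_sqr ?nnegrE ?nrm_ge0// (nrm_T hipK TV adjTV).
  apply: norm2_le => // N; apply: le_trans (psum2_le N hv).
  apply: le_trans (_ : psum2 (D (wshift w (D' v.2))) N.+1 <= _); first exact: psum2_nd.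
  rewrite /psum2 big_ord_recl /D /diag /= scaler0 nrm0 expr0n add0r.
  apply: ler_sum => n _ /=.
  rewrite ler_sqr ?nnegrE ?nrm_ge0// nrmZ nrm_real gtr0_norm//.
  rewrite (le_trans (dw _ _))// /D' /diag nrmZ nrm_real gtr0_norm ?invr_gt0//.
  by rewrite mulrA mulfV ?mul1r// gt_eqF.
Qed.

(** Nearness yields [Z] with [A = Z S_w - T Z]. From [E R(A) = 0], [X] and [A] differ only on the
    first coordinate, and [Q = V (X - A) P_0] satisfies [Q S_w = 0] and [T Q = X - A]; so [Z - Q]
    intertwines for [X]. *)
Lemma decomposition_intertwiner (A : (nat -> H) -> K) (E : V[K, H] -> V[K, H]) :
  bounded_op_l2K A -> (forall v, inV v -> E (Rop T w A v) = 0) ->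
  (forall v, inV v -> Rop T w X v = Rop T w A v + E v) ->
  beta_quad_near w (Rop T w A) (Rop T w (fun _ => 0)) ->
  exists2 Z : (nat -> H) -> K, bounded_op_l2K Z &
    forall x, l2 x -> X x = Z (wshift w x) - T (Z x).
Proof.
move=> hA EA XAE [s Hs].
pose z n h := (beta w n)^-1 *: delta w T A n h.
have zL n : lin (z n).
  by move=> a h k; rewrite /z (delta_lin _ TL n hA) scalerDr !scalerA mulrC.
have zs N (h : nat -> H) : nrm (\sum_(n < N) z n (h n)) <= nrm s * Num.sqrt (psum2 h N).
  (* Nearness speaks of sums with [N.+1] terms, so the empty sum is separate. *)
  case: N => [|N]; first by rewrite !big_ord0 nrm0 mulr_ge0 ?nrm_ge0 ?sqrtr_ge0.
  have hf n : in_first_H ((0, single (h n) 0) : V[K, H]).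
    by split=> // -[].
  have := Hs N _ hf; rewrite first_sum//.
  have -> : \sum_(n < N.+1) vnorm ((0, single (h n) 0) : V[K, H]) ^+ 2 = (psum2 h N.+1)%:C.
    rewrite /psum2 rmorph_sum; apply: eq_bigr => n _.
    have iv : inV ((0, single (h n) 0) : V[K, H]) by exact: l2_single.
    rewrite vnormE// -rmorphXn normV_sqr//= nrm0 expr0n add0r norm2_single.
    by [].
  rewrite sqrtC_real ?psum2_ge0// vnormE; last exact: l2_0.
  move/(real_bound (normV_ge0 _) (sqrtr_ge0 _)); apply: le_trans.
  by rewrite /normV /= norm2_0 addr0 sqrtr_sqr ger0_norm ?nrm_ge0.
have [Z hZ Zz] := coefficient_operator (nrm_ge0 s) zL zs.
(* Dividing by [w n] exhibits [h e_{n+1}] as the sequence component of a vector in the range of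
   R(A), where [E] vanishes. *)
have XA h n : X (single h n.+1) = A (single h n.+1).
  have iv : inV ((0, single ((w n)^-1 *: h) n) : V[K, H]) by exact: l2_single.
  have iu := Rop_inV b0 wb T A iv.
  have := XAE _ iu; rewrite EA// addr0 /Rop /= shift_single scalerA.
  by rewrite mulfV ?gt_eqF// scale1r => -[/addrI].
pose Q x := V (X (single (x 0%N) 0) - A (single (x 0%N) 0)).
have hQ : bounded_op_l2K Q.
  apply: (opl2_post VL) => [k|]; first by rewrite (nrm_V hipK TV adjTV).
  by apply: opl2_sub; exact: opl2_head.
have hZ' : bounded_op_l2K (fun x => Z x - Q x) by exact: opl2_sub.
exists (fun x => Z x - Q x) => //.
apply: opl2_ext => // [|h n].
  apply: opl2_sub.
    by apply: (opl2_comp (shift_lin w) b0 _ hZ') => x; exact: shift_l2.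
  exact: (opl2_post TL (nrm_T hipK TV adjTV) hZ').
have Q0 (x : nat -> H) : x 0%N = 0 -> Q x = 0.
  by move=> x0; rewrite /Q x0 single0 !opl2_0// subrr (lin0 VL).
have TQ : T (Q (single h n)) = X (single h n) - A (single h n).
  case: n => [|n]; first by rewrite /Q TV.
  by rewrite Q0// (lin0 TL) XA subrr.
rewrite (Q0 (wshift _ _))// subr0 shift_single !Zz (linB TL) TQ.
(* This is the recursion [deltaS] divided by [beta w n]. *)
have -> : z n.+1 (w n *: h) = T (z n h) + A (single h n).
  have bw : (beta w n.+1)^-1 * w n = (beta w n)^-1.
    by rewrite betaS invfM -mulrA mulVf ?mulr1// gt_eqF.
  have sE : single (beta w n *: h) n = beta w n *: single h n.
    by have := singleZD (beta w n) h 0 n; rewrite addr0 => ->; rewrite single0 addr0.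
  rewrite /z (linZ (delta_lin _ TL _ hA)) scalerA bw deltaS scalerDr (linZ TL) sE.
  rewrite (opl2Z hA); last exact: l2_single.
  by rewrite scalerA mulVf ?scale1r// beta_neq0.
by rewrite opprB [RHS]addrC subrKA subrK.
Qed.

End Converse.

Unset Implicit Arguments.
Local Close Scope classical_set_scope.
Local Close Scope complex_scope.

Theorem theorem5p1 (R : realType) (H K : completeNormedModType R[i])
  (ipH : H -> H -> R[i]) (ipK : K -> K -> R[i])
  (hipH : inner_product ipH) (hipK : inner_product ipK)
  (w : nat -> R[i]) (w_pos : forall k, 0 < w k)
  (w_bdd : exists b : R[i], forall k, w k <= b)
  (T : K -> K) (T_bdd : bounded_op_K T) (T_coiso : coisometry ipK T)
  (X : (nat -> H) -> K) (X_bdd : bounded_op_l2K X) :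
  similar_to_contraction (Rop T w X)
  <->
  (power_bounded (Rop T w X) /\
   exists (A : (nat -> H) -> K) (E : V[K, H] -> V[K, H]),
     [/\ bounded_op_l2K A, bounded_op_V E,
         (forall v, inV v -> E (E v) = 0) /\
           (forall v, inV v -> E (Rop T w A v) = 0),
         forall v, inV v -> Rop T w X v = Rop T w A v + E v
       & beta_quad_near w (Rop T w A) (Rop T w (fun _ => 0))]).
Proof.
have [TL _] := T_bdd.
have [V [VL TV adjTV]] := coisometry_adjoint hipK TL T_coiso.
have [b wb] := w_bdd.
(* [b] is only assumed to be a complex number; lying above the positive [w 0] makes it real and
   nonnegative. *)
have b0 : 0 <= b by rewrite (le_trans (ltW (w_pos 0%N))).
have wb' k : nrm (w k) <= nrm b.
  by rewrite -lecR -!nrmE !ger0_norm// ltW.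
split=> [sim|[pb [A [E [hA _ [_ EA] XAE near]]]]].
  split; first exact: (similar_power_bounded (nrm_ge0 b) wb' sim).
  exact: (similar_decomposition hipH hipK w_pos (nrm_ge0 b) wb' TL VL TV adjTV X_bdd sim).
have [Z hZ XZ] := decomposition_intertwiner hipK w_pos (nrm_ge0 b) wb' TL VL TV
  adjTV X_bdd hA EA XAE near.
exact: (intertwined_similar hipK w_pos (nrm_ge0 b) wb' TL TV adjTV hZ XZ pb).
Qed.
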